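(* Let $G=(\mathcal{X},\mathcal{A},\mu,V)$ be a $k$-player $\alpha$-anchored game such that $\mathrm{val}(G)\le 1-\varepsilon$. Then for every positive integer $n$, $$\mathrm{val}(G^n)\le \exp\left(-\frac{\alpha^{2k}\cdot\varepsilon^3\cdot n}{384\cdot s\cdot k^2}\right),$$ where $s=\log|\mathcal{A}|$.
   Context: A $k$-player game $G=(\mathcal{X},\mathcal{A},\mu,V)$ consists of finite question sets with $\mathcal{X}=\mathcal{X}^1\times\cdots\times\mathcal{X}^k$, finite answer sets with $\mathcal{A}=\mathcal{A}^1\times\cdots\times\mathcal{A}^k$, a probability measure $\mu$ on $\mathcal{X}$, and a predicate $V:\mathcal{X}\times\mathcal{A}\to\{0,1\}$. The classical value is $\mathrm{val}(G)=\sup_{f^1,\dots,f^k}\mathbb{E}_{x\sim\mu}V(x,(f^1(x^1),\dots,f^k(x^k)))$ over functions $f^t:\mathcal{X}^t\to\mathcal{A}^t$. The $n$-fold parallel repetition $G^n$ is the $k$-player game in which $x_1,\dots,x_n\in\mathcal{X}$ are sampled independently from $\mu$, player $t$ receives $(x_1^t,\dots,x_n^t)$ and answers $(a_1^t,\dots,a_n^t)\in(\mathcal{A}^t)^n$, and the players win iff $V(x_i,a_i)=1$ for all $i\in[n]$, where $a_i=(a_i^1,\dots,a_i^k)$. A $k$-player game is $\alpha$-anchored ($0<\alpha\le1$) if there exist subsets $\mathcal{X}^t_\perp\subseteq\mathcal{X}^t$ ($t\in[k]$) such that (1) for each $t$ the marginal probability under $\mu$ that $x^t\in\mathcal{X}^t_\perp$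 is at least $\alpha$, and (2) for all $x\in\mathcal{X}$, $\mu(x)=\mu(x|_{\overline{F}_x})\prod_{t\in F_x}\mu(x^t)$, where $F_x=\{t\in[k]:x^t\in\mathcal{X}^t_\perp\}$, $\overline{F}_x=[k]\setminus F_x$, $\mu(x|_S)$ is the marginal probability under $\mu$ of the restriction of $x$ to the coordinates in $S$ (equal to $1$ for $S=\emptyset$), and $\mu(x^t)$ is the marginal probability of the $t$-th coordinate. *)

(* Defs.v *)
From HB Require Import structures.
From mathcomp Require Import all_boot all_order all_algebra.
From mathcomp Require Import all_classical all_reals all_analysis.
Set Implicit Arguments.
Unset Strict Implicit.
Unset Printing Implicit Defensive.
Import Order.TTheory GRing.Theory Num.Theory.
Local Open Scope ring_scope.

(* A k-player game: players indexed by 'I_k, question sets X t, answer sets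
   A t (finite types), joint question space {dffun forall t, X t}, measure
   mu on it, predicate V. *)

Definition qspace (k : nat) (X : 'I_k -> finType) : finType :=
  {dffun forall t : 'I_k, X t}.

Definition strategy (k : nat) (X A : 'I_k -> finType) : finType :=
  {dffun forall t : 'I_k, {ffun X t -> A t}}.

Definition answers_of (k : nat) (X A : 'I_k -> finType)
  (f : strategy X A) (x : qspace X) : qspace A :=
  [ffun t => f t (x t)].

Definition win_prob (R : realType) (k : nat) (X A : 'I_k -> finType)
  (mu : qspace X -> R) (V : qspace X -> qspace A -> bool) (f : strategy X A) : R :=
  \sum_(x : qspace X) mu x * (V x (answers_of f x))%:R.

Definition game_val (R : realType) (k : nat) (X A : 'I_k -> finType)
  (mu : qspace X -> R) (V : qspace X -> qspace A -> bool) : R :=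
  \big[Num.max/0]_(f : strategy X A) win_prob mu V f.

Definition is_prob (R : realType) (k : nat) (X : 'I_k -> finType)
  (mu : qspace X -> R) : Prop :=
  (forall x, 0 <= mu x) /\ \sum_(x : qspace X) mu x = 1.

Definition marg_restr (R : realType) (k : nat) (X : 'I_k -> finType)
  (mu : qspace X -> R) (S : {set 'I_k}) (x : qspace X) : R :=
  \sum_(y : qspace X | [forall t in S, y t == x t]) mu y.

Definition marg1 (R : realType) (k : nat) (X : 'I_k -> finType)
  (mu : qspace X -> R) (t : 'I_k) (x : qspace X) : R :=
  \sum_(y : qspace X | y t == x t) mu y.

Definition anchored (R : realType) (k : nat) (X : 'I_k -> finType)
  (alpha : R) (mu : qspace X -> R) : Prop :=
  0 < alpha <= 1 /\
  exists Xp : forall t : 'I_k, {set X t},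
    (forall t : 'I_k, alpha <= \sum_(x : qspace X | x t \in Xp t) mu x) /\
    (forall x : qspace X,
        let F := [set t | x t \in Xp t] in
        mu x = marg_restr mu (~: F) x * \prod_(t in F) marg1 mu t x).

Definition repT (k n : nat) (X : 'I_k -> finType) : 'I_k -> finType :=
  fun t => {ffun 'I_n -> X t}.

Definition round (k n : nat) (X : 'I_k -> finType)
  (x : qspace (repT n X)) (i : 'I_n) : qspace X :=
  [ffun t => x t i].

Definition rep_mu (R : realType) (k n : nat) (X : 'I_k -> finType)
  (mu : qspace X -> R) : qspace (repT n X) -> R :=
  fun x => \prod_(i < n) mu (round x i).

Definition rep_V (k n : nat) (X A : 'I_k -> finType)
  (V : qspace X -> qspace A -> bool) :
  qspace (repT n X) -> qspace (repT n A) -> bool :=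
  fun x a => [forall i : 'I_n, V (round x i) (round a i)].

Definition log_answers (R : realType) (k : nat) (A : 'I_k -> finType) : R :=
  ln (#|qspace A|%:R : R) / ln 2.
Arguments rep_mu {R k} n {X} mu.
Arguments rep_V {k} n {X A} V.
Arguments log_answers {R k} A.

(* Main.v *)
Require Import Defs.
From HB Require Import structures.
From mathcomp Require Import all_boot all_order all_algebra.
From mathcomp Require Import all_classical all_reals all_analysis.
From mathcomp Require Import ring lra zify.
(* Restores the [finset] names shadowed by [classical_sets]. *)
From mathcomp Require Import fintype finset.
Import Order.TTheory GRing.Theory Num.Theory.
Local Open Scope ring_scope.
Set Implicit Arguments.
Unset Strict Implicit.
Unset Printing Implicit Defensive.

(**
Fix a strategy for the repeated game and condition on the event [W] of winning
the rounds in a small set [C].  For every other round [j] reveal a random player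
[t] together with a question tuple that agrees with that of round [j] except
that its [t]-th coordinate has been resampled.  Given these hints, and the
questions and answers in [C], the questions of different players are
independent.

Conditioning a product measure on an event of probability [N] moves the
marginals by [\sum_j d_j ^ 2 <= 4 ln (1 / N)] in [L1]; averaging over the hints
and the at most [|A| ^ |C|] answers, some round [i] outside [C] moves little.
Hence the conditional weight [g] of the rest of the experiment, as a function of
the question tuple [x] of round [i], is close in [L1(mu)] to its conditional
expectation given all coordinates of [x] but the [t]-th, for each [t].

For an anchored [mu] this forces [g] to be close to a constant: the coordinates
that fall into the anchor sets are independent of the others, so averaging over
the anchors of one coordinate after the other costs a factor [1 / alpha] per
coordinate and ends with a constant.  So the rest of the experiment can be
sampled independently of [x], each player completing its own questions locally.
This is a randomised strategy for [G], whence winning round [i] given [W] has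
probability at most [1 - eps / 2], and one iterates.
*)

(** * Dependent product spaces: overwriting a coordinate, lines parallel to an axis, product
    weights *)

Section ProductSpace.
Variables (k : nat) (X : 'I_k -> finType).
Implicit Types (x y : qspace X) (t s : 'I_k).

Definition upd x t (v : X t) : qspace X := [ffun s => dfwith x t v s].

Lemma upd_in x t (v : X t) : upd x v t = v.
Proof. by rewrite ffunE dfwithin. Qed.

Lemma upd_out x t (v : X t) s : s != t -> upd x v s = x s.
Proof. by move=> st; rewrite ffunE dfwithout // eq_sym. Qed.

Lemma upd_id x t : upd x (x t) = x.
Proof.
apply/ffunP => s; have [->|st] := eqVneq s t; first by rewrite upd_in.
by rewrite upd_out.
Qed.

Lemma upd_upd x t (u v : X t) : upd (upd x u) v = upd x v.
Proof.
apply/ffunP => s; have [->|st] := eqVneq s t; first by rewrite !upd_in.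
by rewrite !upd_out.
Qed.

Lemma updC x s t (u : X s) (v : X t) : s != t ->
  upd (upd x u) v = upd (upd x v) u.
Proof.
move=> st; apply/ffunP => r.
have [->|rt] := eqVneq r t.
  by rewrite upd_in upd_out 1?eq_sym // upd_in.
rewrite upd_out //; have [->|rs] := eqVneq r s; first by rewrite !upd_in.
by rewrite !upd_out.
Qed.

Definition offeq t x y := [forall s, (s != t) ==> (x s == y s)].

Lemma offeqP t x y : reflect (y = upd x (y t)) (offeq t x y).
Proof.
apply: (iffP idP) => [/forallP xy|->].
  apply/ffunP => s; have [->|st] := eqVneq s t; first by rewrite upd_in.
  by rewrite upd_out //; apply/esym/eqP; have := xy s; rewrite st.
by apply/forallP => s; apply/implyP => st; rewrite upd_out.
Qed.

Lemma offeq_upd t x (v : X t) : offeq t x (upd x v).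
Proof. by apply/offeqP; rewrite upd_in. Qed.

Lemma offeq_sym t x y : offeq t x y = offeq t y x.
Proof. by apply: eq_forallb => s; rewrite [x s == _]eq_sym. Qed.

(** Walk from [x] to [y], overwriting one coordinate after the other. *)
Lemma const_of_upd (S : Type) (H : qspace X -> S) :
  (forall x t (v : X t), H (upd x v) = H x) -> forall x y, H x = H y.
Proof.
move=> Hupd x y; pose z := foldr (fun t w => upd w (y t)) x (enum 'I_k).
have -> : H x = H z.
  by rewrite /z; elim: (enum 'I_k) => //= t r IH; rewrite Hupd.
suff zE t : t \in enum 'I_k -> z t = y t.
  by congr H; apply/ffunP => t; apply: zE; rewrite mem_enum.
rewrite /z; elim: (enum 'I_k) => //= s r IH; rewrite inE.
have [->|ts] := eqVneq t s; first by rewrite upd_in.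
by rewrite upd_out.
Qed.

Variable R : realType.

Lemma sum_offeq t x (F : qspace X -> R) :
  \sum_(y | offeq t x y) F y = \sum_(v : X t) F (upd x v).
Proof.
rewrite (reindex_onto (fun v : X t => upd x v) (fun y : qspace X => y t)) /=; last first.
  by move=> y /offeqP.
by apply: eq_bigl => v; rewrite offeq_upd upd_in eqxx.
Qed.

(** Disintegration along the lines parallel to axis [t]; [v0] only selects a base point on each
    line. *)
Lemma sum_upd t (v0 : X t) (F : qspace X -> R) :
  \sum_y F y = \sum_(y : qspace X | y t == v0) \sum_(v : X t) F (upd y v).
Proof.
rewrite (partition_big (fun y => upd y v0) (fun y : qspace X => y t == v0)) /=; last first.
  by move=> y _; rewrite upd_in.
apply: eq_bigr => y /eqP yt; rewrite -sum_offeq; apply: eq_bigl => z.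
rewrite offeq_sym; apply/eqP/offeqP => [<-|->]; last by rewrite yt.
by rewrite upd_in.
Qed.

Lemma sum_prod_distr (F : forall t, X t -> R) :
  \sum_(x : qspace X) \prod_t F t (x t) = \prod_t \sum_(v : X t) F t v.
Proof.
pose P t : {ffun X t -> R} := [ffun v => F t v].
rewrite (reindex (@dffun_of_fprod _ X)); last exact/onW_bij/dffun_of_fprod_bij.
transitivity (\sum_(f : fprod X) \prod_(t in 'I_k) P t (f t)).
  by apply: eq_bigr => f _; apply: eq_bigr => t _; rewrite !ffunE.
rewrite big_fprod -(bigA_distr_big_dep (tagged_with X) (fun t => untag 0 (P t))).
apply: eq_bigr => t _; rewrite -(big_tag (fun t => P t)).
by apply: eq_bigr => v _; rewrite ffunE.
Qed.

End ProductSpace.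

(** * Products of indicators and inequalities for finite sums *)

Lemma prodr_natb (R : comPzSemiRingType) (I : finType) (P : pred I) (b : I -> bool) :
  \prod_(i | P i) ((b i)%:R : R) = [forall (i | P i), b i]%:R.
Proof.
have [/forallP H|] := boolP [forall (i | P i), b i].
  by rewrite big1 // => i Pi; have := H i; rewrite Pi /= => ->.
rewrite negb_forall => /existsP[i]; rewrite negb_imply => /andP[Pi /negbTE bi].
by rewrite (bigD1 i) //= bi mul0r.
Qed.

Lemma prodr_qspace_eq (R : comPzSemiRingType) (k : nat) (X : 'I_k -> finType)
  (x y : qspace X) : \prod_s ((x s == y s)%:R : R) = (x == y)%:R.
Proof.
rewrite prodr_natb; suff -> : (x == y) = [forall s, x s == y s] by [].
apply/eqP/forallP => [-> s //|E].
by apply/ffunP => s; rewrite (eqP (E s)).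
Qed.

Section FiniteSums.
Variables (R : realType) (I : finType).

Lemma ler_sum_imp (P Q : pred I) (F : I -> R) :
  (forall i, 0 <= F i) -> (forall i, P i -> Q i) ->
  \sum_(i | P i) F i <= \sum_(i | Q i) F i.
Proof.
move=> F0 PQ; rewrite [leRHS](bigID P) /=.
rewrite [X in _ <= X + _](eq_bigl P) => [|i].
  by rewrite lerDl sumr_ge0.
by have [/PQ ->|_] := boolP (P i); rewrite ?andbF.
Qed.

Lemma cauchy_schwarz_sum (a b : I -> R) :
  (\sum_i a i * b i) ^+ 2 <= (\sum_i a i ^+ 2) * (\sum_i b i ^+ 2).
Proof.
set S := \sum_i a i * b i; set A := \sum_i a i ^+ 2; set B := \sum_i b i ^+ 2.
have A0 : 0 <= A by apply: sumr_ge0 => i _; apply: sqr_ge0.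
have [A00|A0'] := eqVneq A 0.
  have a0 i : a i = 0.
    apply/eqP; rewrite -(sqrf_eq0 (a i)); move/eqP: A00.
    rewrite psumr_eq0; last by move=> j _; apply: sqr_ge0.
    by move=> /allP/(_ i); rewrite mem_index_enum => /(_ isT).
  by rewrite /S A00 big1 ?expr0n ?mul0r // => i _; rewrite a0 mul0r.
have : 0 <= \sum_i (A * b i - S * a i) ^+ 2 by apply: sumr_ge0 => i _; apply: sqr_ge0.
have -> : \sum_i (A * b i - S * a i) ^+ 2 = A * (A * B - S ^+ 2).
  rewrite (eq_bigr (fun i => A ^+ 2 * b i ^+ 2 + (- (2 * A * S)) * (a i * b i)
    + S ^+ 2 * a i ^+ 2)); last by move=> i _; ring.
  by rewrite !big_split /= -!mulr_sumr -/A -/B -/S; ring.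
by rewrite pmulr_rge0 ?subr_ge0 // lt_neqAle eq_sym A0' A0.
Qed.

End FiniteSums.

(** * Independence of the anchor coordinates *)

Section SetFunctions.
Variables (R : realType) (k : nat) (m : 'I_k -> R) (Q : {set 'I_k} -> R).
Variable U : {set 'I_k}.
Hypothesis m01 : forall t, 0 <= m t <= 1.
Hypothesis Qstep : forall (J : {set 'I_k}) u, J \subset U -> u \in U -> u \notin J ->
  Q J - Q (u |: J) = (Q set0 - Q [set u]) * \prod_(j in J) m j.
Hypothesis QU : Q U = Q set0 * \prod_(j in U) m j.
Hypothesis Q1 : forall u, u \in U -> m u = 1 -> Q [set u] = Q set0.

(** Induction on [#|J|]: when [u] joins [J :\ u], the loss is [c * (1 - m u)] times the product over
    [J :\ u], and these losses telescope. Below, [Q J] is the mass of a cylinder whose coordinates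
    in [J] are anchors. *)
Lemma set_fun_affine c :
  (forall u, u \in U -> Q set0 - Q [set u] = c * (1 - m u)) ->
  forall J : {set 'I_k}, J \subset U -> Q J = Q set0 - c * (1 - \prod_(j in J) m j).
Proof.
move=> Hc J; move: {2}#|J| (erefl #|J|) => d; elim: d J => [|d IH] J.
  by move=> /eqP; rewrite cards_eq0 => /eqP -> _; rewrite big_set0; ring.
move=> cJ JU; have /card_gt0P[u uJ] : (0 < #|J|)%N by rewrite cJ.
have uU := subsetP JU u uJ.
have sJ : J :\ u \subset U by apply: subset_trans JU; apply: subD1set.
have cJ' : #|J :\ u| = d by move: cJ; rewrite (cardsD1 u) uJ => -[].
have uJ' : u \notin J :\ u by rewrite setD11.
have := Qstep sJ uU uJ'; rewrite setD1K // (IH _ cJ' sJ) Hc // (big_setD1 u uJ) /=.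
set p := \prod_(j in _) _ => H.
have -> : Q J = Q set0 - c * (1 - p) - c * (1 - m u) * p by rewrite -H; ring.
by ring.
Qed.

(* If [Q] loses [c (1 - m u)] when [u] enters, then comparing with [QU] forces
   [c = Q set0]; the constant [c] does not depend on [u] because inserting two
   indices in either order gives the same set. *)
Lemma set_fun_product (J : {set 'I_k}) :
  J \subset U -> Q J = Q set0 * \prod_(j in J) m j.
Proof.
move=> JU.
rewrite (@set_fun_affine (Q set0)) //; first by ring.
move=> u uU; have [mu1|mu1] := eqVneq (m u) 1; first by rewrite Q1 // mu1; ring.
have mu1' : 1 - m u != 0 by rewrite subr_eq0 eq_sym.
pose c := (Q set0 - Q [set u]) / (1 - m u).
have Hc v : v \in U -> Q set0 - Q [set v] = c * (1 - m v).
  move=> vU; have [->|vu] := eqVneq v u; first by rewrite /c divfK.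
  have := @Qstep [set u] v; rewrite sub1set uU vU inE vu => /(_ isT isT isT).
  have := @Qstep [set v] u; rewrite sub1set uU vU inE eq_sym vu => /(_ isT isT isT).
  rewrite !big_set1 setUC => H1 H2; apply: (mulIf mu1').
  have -> : c * (1 - m v) * (1 - m u) = (Q set0 - Q [set u]) * (1 - m v).
    by rewrite mulrAC /c divfK.
  by rewrite !mulrBr -H1 -H2; ring.
have := set_fun_affine Hc (subxx U); rewrite QU.
set p := \prod_(j in U) m j => H.
have p1 : 1 - p != 0.
  rewrite subr_eq0 eq_sym neq_lt /p (big_setD1 u uU) /=; apply/orP; left.
  apply: le_lt_trans (_ : m u < 1); last by rewrite lt_neqAle mu1; case/andP: (m01 u).
  apply: ler_piMr; first by case/andP: (m01 u).
  by apply: prodr_ile1 => j _; apply: m01.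
have cE : c = Q set0.
  by apply: (mulIf p1); apply/eqP; rewrite -subr_eq0; apply/eqP; move: H; lra.
by rewrite Hc // cE.
Qed.

End SetFunctions.

Lemma forall_setU1 (I : finType) (u : I) (S : {set I}) (p : pred I) :
  [forall s in u |: S, p s] = p u && [forall s in S, p s].
Proof.
apply/forall_inP/andP => [H|[pu /forall_inP H] s].
  split; first by apply: H; rewrite setU11.
  by apply/forall_inP => s sS; apply: H; rewrite inE sS orbT.
by rewrite !inE => /orP[/eqP->//|]; apply: H.
Qed.

Definition mass1 (R : realType) (k : nat) (X : 'I_k -> finType)
    (mu : qspace X -> R) t (v : X t) : R :=
  \sum_(y : qspace X | y t == v) mu y.

Definition off_marg (R : realType) (k : nat) (X : 'I_k -> finType)
    (mu : qspace X -> R) t (x : qspace X) : R :=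
  \sum_(v : X t) mu (upd x v).

Section Anchors.
Variables (R : realType) (k : nat) (X : 'I_k -> finType).
Variables (mu : qspace X -> R) (Xp : forall t, {set X t}).
Hypothesis mu_ge0 : forall x, 0 <= mu x.
Hypothesis mu_sum1 : \sum_x mu x = 1.
Hypothesis mu_anchored : forall x : qspace X,
  let F := [set t | x t \in Xp t] in
  mu x = marg_restr mu (~: F) x * \prod_(t in F) marg1 mu t x.

Definition anchor_mass t : R := \sum_(v in Xp t) mass1 mu v.

Lemma anchor_massE t : anchor_mass t = \sum_(x : qspace X | x t \in Xp t) mu x.
Proof.
rewrite (partition_big (fun x : qspace X => x t) (mem (Xp t))) //=.
apply: eq_bigr => v vX; apply: eq_bigl => x.
by have [->|] := eqVneq (x t) v; rewrite ?vX ?andbF.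
Qed.

Lemma anchor_mass01 t : 0 <= anchor_mass t <= 1.
Proof.
rewrite anchor_massE sumr_ge0 //= -mu_sum1.
by rewrite [leRHS](bigID (fun x : qspace X => x t \in Xp t)) /= lerDl sumr_ge0.
Qed.

(** Interpolates between the marginal of [x] on [S], at [J = set0], and the event that all other
    coordinates are anchors, at [J = ~: S]. *)
Definition cyl (S : {set 'I_k}) (x : qspace X) (J : {set 'I_k}) : R :=
  \sum_(y : qspace X | [forall s in S, y s == x s] && [forall j in J, y j \in Xp j]) mu y.

Lemma cyl0 S x : cyl S x set0 = marg_restr mu S x.
Proof.
apply: eq_bigl => y; suff -> : [forall j in set0, y j \in Xp j] by rewrite andbT.
by apply/forall_inP => j; rewrite inE.
Qed.

(** Coordinate [u] either is an anchor or takes a non-anchor value, which then joins the fixed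
    coordinates. *)
Lemma cyl_split (S : {set 'I_k}) (x : qspace X) (J : {set 'I_k}) u : u \notin S ->
  cyl S x J = cyl S x (u |: J) + \sum_(v | v \notin Xp u) cyl (u |: S) (upd x v) J.
Proof.
move=> uS; rewrite {1}/cyl (bigID (fun y : qspace X => y u \in Xp u)) /=.
congr (_ + _).
  by apply: eq_bigl => y; rewrite forall_setU1 -andbA [_ && (_ \in _)]andbC.
rewrite (partition_big (fun y : qspace X => y u) (fun v => v \notin Xp u)) /=; last first.
  by move=> y /andP[].
apply: eq_bigr => v vX; apply: eq_bigl => y; rewrite forall_setU1 upd_in.
have -> : [forall s in S, y s == upd x v s] = [forall s in S, y s == x s].
  apply: eq_forallb => s; have [sS|//] := boolP (s \in S).
  by rewrite upd_out //; apply: contraNneq uS => <-.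
by have [->|] := eqVneq (y u) v; rewrite ?vX ?andbF ?andbT.
Qed.

(** The anchor coordinates of every tuple in this cylinder are exactly [~: S], so [mu_anchored]
    gives an explicit product and the sum factorises. *)
Lemma cyl_full (S : {set 'I_k}) (x : qspace X) : (forall s, s \in S -> x s \notin Xp s) ->
  cyl S x (~: S) = cyl S x set0 * \prod_(j in ~: S) anchor_mass j.
Proof.
move=> xS.
pose F t (v : X t) : R :=
  if t \in S then (v == x t)%:R else (v \in Xp t)%:R * mass1 mu v.
have -> : \prod_(j in ~: S) anchor_mass j = \prod_j \sum_(v : X j) F j v.
  rewrite [RHS](bigID (mem S)) /= [X in X * _]big1 ?mul1r; last first.
    move=> t tS; rewrite (bigD1 (x t)) //= /F tS eqxx big1 ?addr0 //.
    by move=> v /negbTE ->.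
  apply: eq_big => t; rewrite inE // => tS.
  rewrite /F (negbTE tS) /anchor_mass big_mkcond; apply: eq_bigr => v _.
  by case: ifP; rewrite ?mul1r ?mul0r.
rewrite -sum_prod_distr mulr_sumr /cyl big_mkcond /=; apply: eq_bigr => y _.
have -> : \prod_t F t (y t) =
    ([forall s in S, y s == x s] && [forall j in ~: S, y j \in Xp j])%:R *
    \prod_(t in ~: S) marg1 mu t y.
  rewrite (bigID (mem S)) /= -mulnb natrM -!prodr_natb -mulrA -big_split /=.
  congr (_ * _); first by apply: eq_bigr => t tS; rewrite /F tS.
  apply: eq_big => t; first by rewrite inE.
  by rewrite /F => /negbTE ->.
case: ifP => [/andP[/forall_inP yS /forall_inP yJ]|_]; last by rewrite mul0r mulr0.
rewrite mul1r mu_anchored (_ : [set t | _] = ~: S); last first.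
  apply/setP => t; rewrite !inE; case: (boolP (t \in S)) => tS /=; last first.
    by apply: yJ; rewrite inE.
  by rewrite (eqP (yS t tS)); apply/negbTE/xS.
congr (_ * _); rewrite setCK -cyl0; apply: eq_bigl => z.
congr (_ && _); apply: eq_forallb => s.
by have [sS|] := boolP (s \in S) => //=; rewrite (eqP (yS s sS)).
Qed.

(** Induction on the number of free coordinates: by [cyl_split] the decrements in [J] are sums of
    cylinders with one more fixed coordinate, which yields the recursion required by
    [set_fun_product]. *)
Lemma cyl_product (S : {set 'I_k}) (x : qspace X) (J : {set 'I_k}) :
  (forall s, s \in S -> x s \notin Xp s) ->
  J \subset ~: S -> cyl S x J = cyl S x set0 * \prod_(j in J) anchor_mass j.
Proof.
move: {2}#|~: S| (leqnn #|~: S|) => d; elim: d S x J => [|d IH] S x J Sd xS JS.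
  move: Sd; rewrite leqn0 cards_eq0 => /eqP S0.
  by move: JS; rewrite S0 subset0 => /eqP ->; rewrite big_set0 mulr1.
apply: (set_fun_product (U := ~: S)) => //; first exact: anchor_mass01.
- move=> I u IS; rewrite inE => uS uI.
  rewrite (cyl_split x I uS) addrAC subrr add0r.
  rewrite (cyl_split x set0 uS) setU0 addrAC subrr add0r mulr_suml.
  apply: eq_bigr => v vX; apply: IH.
  + rewrite -ltnS; apply: leq_trans Sd; apply: proper_card.
    by apply/properP; split; [rewrite setCS subsetU1|exists u; rewrite !inE ?eqxx].
  + move=> s; rewrite !inE; have [->|su] /= := eqVneq s u; first by rewrite upd_in.
    by move=> sS; rewrite upd_out // xS.
  + apply/subsetP => s sI; rewrite !inE negb_or; apply/andP; split.
      by apply: contraNneq uI => <-.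
    by move/subsetP: IS => /(_ s sI); rewrite inE.
- exact: cyl_full.
(* If coordinate [u] is almost surely an anchor, the non-anchor term of the split is null. *)
- move=> u; rewrite inE => uS m1; rewrite (cyl_split x set0 uS) setU0.
  rewrite big1 ?addr0 // => v vX; apply/eqP.
  have H : \sum_(y : qspace X | y u \notin Xp u) mu y = 0.
    move: mu_sum1; rewrite (bigID (fun y : qspace X => y u \in Xp u)) /= -anchor_massE m1.
    by move=> H; lra.
  rewrite eq_le; apply/andP; split; last exact: sumr_ge0.
  rewrite -H; apply: ler_sum_imp => // y; rewrite forall_setU1 upd_in.
  by case/andP => /andP[/eqP -> _] _.
Qed.

(** Along the line through [x], anchors contribute the fraction [anchor_mass t] of
    [marg_restr mu (~: F) x * P] to [off_marg], and by [cyl_product] the non-anchors contribute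
    exactly the rest. *)
Lemma anchor_independent (x : qspace X) t (u : X t) : u \in Xp t ->
  mu (upd x u) = off_marg mu t x * mass1 mu u.
Proof.
move=> uX; pose F := [set s | upd x u s \in Xp s].
have tF : t \in F by rewrite inE upd_in.
have tS : t \notin ~: F by rewrite inE negbK.
have xF s : s != t -> (s \in F) = (x s \in Xp s) by move=> st; rewrite inE upd_out.
pose P := \prod_(s in F :\ t) marg1 mu s x.
have margE (v : X t) (S : {set 'I_k}) : t \notin S -> marg_restr mu S (upd x v) = marg_restr mu S x.
  move=> tS'; apply: eq_bigl => y; apply: eq_forallb => s.
  have [sS|//] := boolP (s \in S).
  by rewrite upd_out //; apply: contraNneq tS' => <-.
have PE (v : X t) : \prod_(s in F :\ t) marg1 mu s (upd x v) = P.
  apply: eq_bigr => s; rewrite !inE => /andP[st _].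
  by rewrite /marg1 upd_out.
have muX (v : X t) : v \in Xp t -> mu (upd x v) = marg_restr mu (~: F) x * (mass1 mu v * P).
  move=> vX; rewrite mu_anchored (_ : [set s | _] = F); last first.
    apply/setP => s; have [->|st] := eqVneq s t; first by rewrite tF inE upd_in vX.
    by rewrite xF // inE upd_out.
  by rewrite margE // (big_setD1 t) //= PE {1}/marg1 upd_in.
have muN (v : X t) : v \notin Xp t ->
    mu (upd x v) = cyl (t |: ~: F) (upd x v) set0 * P.
  move=> vX; rewrite mu_anchored (_ : [set s | _] = F :\ t); last first.
    apply/setP => s; have [->|st] := eqVneq s t.
      by rewrite !inE upd_in (negbTE vX) eqxx.
    by rewrite in_setD1 st /= xF // inE upd_out.
  by rewrite PE cyl0 setCD setUC.
have xS s : s \in ~: F -> x s \notin Xp s.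
  move=> sF; rewrite -xF; first by rewrite inE in sF.
  by apply: contraNneq tS => <-.
have c1 : cyl (~: F) x [set t] = cyl (~: F) x set0 * anchor_mass t.
  by rewrite cyl_product ?big_set1 // sub1set inE.
have := cyl_split x set0 tS; rewrite setU0 c1 => H.
rewrite /off_marg (bigID (mem (Xp t))) /= (eq_bigr _ muX) (eq_bigr _ muN) muX //.
rewrite -mulr_sumr -!mulr_suml -/(anchor_mass t) -cyl0.
set S := \sum_(_ | _) _ in H *.
have -> : S = cyl (~: F) x set0 - cyl (~: F) x set0 * anchor_mass t by rewrite {1}H; ring.
by ring.
Qed.

End Anchors.

(** * A Poincaré inequality for anchored distributions *)

(* The conditional expectation of [g] given all coordinates but the [t]-th,
   equal to [0] where the conditioning event is null. *)
Definition cexp (R : realType) (k : nat) (X : 'I_k -> finType)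
    (mu : qspace X -> R) t (g : qspace X -> R) (x : qspace X) : R :=
  (\sum_(v : X t) mu (upd x v) * g (upd x v)) / off_marg mu t x.

Lemma off_marg_upd (R : realType) (k : nat) (X : 'I_k -> finType)
  (mu : qspace X -> R) t x (v : X t) : off_marg mu t (upd x v) = off_marg mu t x.
Proof. by apply: eq_bigr => u _; rewrite upd_upd. Qed.

Lemma cexp_upd (R : realType) (k : nat) (X : 'I_k -> finType)
  (mu : qspace X -> R) t g x (v : X t) : cexp mu t g (upd x v) = cexp mu t g x.
Proof.
by rewrite /cexp off_marg_upd; congr (_ / _); apply: eq_bigr => u _; rewrite upd_upd.
Qed.

Section Poincare.
Variables (R : realType) (k : nat) (X : 'I_k -> finType).
Variables (mu : qspace X -> R) (Xp : forall t, {set X t}) (alpha : R).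
Hypothesis mu_ge0 : forall x, 0 <= mu x.
Hypothesis mu_sum1 : \sum_x mu x = 1.
Hypothesis mu_anchored : forall x : qspace X,
  let F := [set t | x t \in Xp t] in
  mu x = marg_restr mu (~: F) x * \prod_(t in F) marg1 mu t x.
Hypothesis alpha01 : 0 < alpha <= 1.
Hypothesis alpha_le : forall t, alpha <= anchor_mass mu Xp t.

Let alpha_gt0 : 0 < alpha. Proof. by case/andP: alpha01. Qed.
Let am_gt0 t : 0 < anchor_mass mu Xp t. Proof. exact: lt_le_trans (alpha_le t). Qed.

(** The [t]-th coordinate is replaced by a fresh anchor, drawn from its marginal conditioned on the
    anchor set. *)
Definition aexp t (f : qspace X -> R) (x : qspace X) : R :=
  (\sum_(v in Xp t) mass1 mu v * f (upd x v)) / anchor_mass mu Xp t.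

Definition L1 (f : qspace X -> R) : R := \sum_x mu x * `|f x|.

Lemma qspace_inhabited : exists x0 : qspace X, true.
Proof.
have [x0 _|h] := pickP (@predT (qspace X)); first by exists x0.
have : \sum_x mu x = 0 by apply: big1 => x _; have := h x.
by rewrite mu_sum1 => /eqP; rewrite oner_eq0.
Qed.

Lemma L1_triangle (f g h : qspace X -> R) :
  L1 (fun x => f x - h x) <= L1 (fun x => f x - g x) + L1 (fun x => g x - h x).
Proof.
rewrite /L1 -big_split; apply: ler_sum => x _ /=.
rewrite -mulrDr ler_wpM2l //; apply: le_trans (ler_normD _ _).
by rewrite addrA subrK.
Qed.

Lemma mass1_ge0 t (v : X t) : 0 <= mass1 mu v.
Proof. exact: sumr_ge0. Qed.

Lemma aexpB t f g x : aexp t (fun y => f y - g y) x = aexp t f x - aexp t g x.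
Proof.
rewrite /aexp -mulrBl; congr (_ / _); rewrite -sumrB.
by apply: eq_bigr => v _; rewrite mulrBr.
Qed.

(** By [anchor_independent], a fresh anchor on a line has the weight that [mu] gives to the anchors
    of that line, so only the normalisation by [anchor_mass] is lost. *)
Lemma L1_aexp t f : L1 (aexp t f) <= alpha^-1 * L1 f.
Proof.
have [x0 _] := qspace_inhabited.
have [am0 am0'] := (am_gt0 t, lt0r_neq0 (am_gt0 t)).
suff H : anchor_mass mu Xp t * L1 (aexp t f) <= L1 f.
  rewrite ler_pdivlMl //; apply: le_trans H.
  by apply: ler_wpM2r => //; apply: sumr_ge0 => x _; rewrite mulr_ge0.
apply: le_trans (_ : \sum_x mu x * (\sum_(v in Xp t) mass1 mu v * `|f (upd x v)|) <= _).
  rewrite /L1 mulr_sumr; apply: ler_sum => x _.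
  rewrite mulrCA ler_wpM2l // /aexp normrM normfV (ger0_norm (ltW am0)).
  rewrite mulrC divfK //; apply: le_trans (ler_norm_sum _ _ _) _.
  by apply: ler_sum => v _; rewrite normrM (ger0_norm (mass1_ge0 v)).
rewrite /L1 !(sum_upd (x0 t)); apply: ler_sum => y _.
under eq_bigr do under eq_bigr do rewrite upd_upd.
rewrite -mulr_suml -/(off_marg mu t y) mulr_sumr.
apply: le_trans (_ : \sum_(v in Xp t) mu (upd y v) * `|f (upd y v)| <= _).
  by apply: ler_sum => v vX; rewrite (anchor_independent (mu := mu) (Xp := Xp)) // mulrA.
by apply: ler_sum_imp => // v; rewrite mulr_ge0.
Qed.

Lemma aexp_cexp t g x : aexp t (cexp mu t g) x = cexp mu t g x.
Proof.
rewrite /aexp; under eq_bigr do rewrite cexp_upd.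
by rewrite -mulr_suml mulrC mulrA mulVf ?mul1r // lt0r_neq0.
Qed.

(** [aexp t] fixes [cexp mu t g], which ignores the [t]-th coordinate; the triangle inequality
    through it costs [1 + alpha^-1 <= 2 * alpha^-1]. *)
Lemma L1_aexp_cexp t g :
  L1 (fun x => g x - aexp t g x) <= 2 * alpha^-1 * L1 (fun x => g x - cexp mu t g x).
Proof.
apply: le_trans (L1_triangle _ (cexp mu t g) _) _.
have -> : L1 (fun x => cexp mu t g x - aexp t g x) =
    L1 (aexp t (fun x => g x - cexp mu t g x)).
  by apply: eq_bigr => x _; rewrite aexpB aexp_cexp distrC.
have := L1_aexp t (fun x => g x - cexp mu t g x).
set d := L1 (fun x => g x - cexp mu t g x) => Hd.
have d0 : 0 <= d by apply: sumr_ge0 => x _; rewrite mulr_ge0.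
have : d <= alpha^-1 * d.
  by rewrite ler_peMl // invf_ge1 //; case/andP: alpha01.
by move: Hd; set z := alpha^-1 * d; set w := L1 _; rewrite -mulrA -/z; lra.
Qed.

(** Each further average multiplies the error made so far by at most [alpha^-1]. *)
Lemma L1_foldr_aexp g (r : seq 'I_k) :
  L1 (fun x => g x - foldr aexp g r x) <=
  2 * alpha^-1 ^+ size r * \sum_(t <- r) L1 (fun x => g x - cexp mu t g x).
Proof.
elim: r => [|t r IH] /=.
  by rewrite big_nil mulr0 /L1 big1 // => x _; rewrite subrr normr0 mulr0.
rewrite big_cons; apply: le_trans (L1_triangle _ (aexp t g) _) _.
have -> : L1 (fun x => aexp t g x - aexp t (foldr aexp g r) x) =
    L1 (aexp t (fun x => g x - foldr aexp g r x)).
  by apply: eq_bigr => x _; rewrite aexpB.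
have H1 := L1_aexp_cexp t g.
have H2 := L1_aexp t (fun x => g x - foldr aexp g r x).
have ia0 : 0 <= alpha^-1 by rewrite invr_ge0 ltW.
have H3 := ler_wpM2l ia0 IH.
set D := \sum_(_ <- _) _ in IH H3 *; set d := L1 (fun x => g x - cexp mu t g x) in H1 *.
have d0 : 0 <= d by apply: sumr_ge0 => x _; rewrite mulr_ge0.
apply: le_trans (lerD H1 (le_trans H2 H3)) _.
rewrite exprS (_ : 2 * (alpha^-1 * alpha^-1 ^+ size r) * (d + D) =
  2 * alpha^-1 * d * alpha^-1 ^+ size r + alpha^-1 * (2 * alpha^-1 ^+ size r * D)); last by ring.
rewrite lerD2r ler_peMr //; first by rewrite !mulr_ge0.
by rewrite exprn_ege1 // invf_ge1 //; case/andP: alpha01.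
Qed.

Lemma foldr_aexp_upd g (r : seq 'I_k) x t (v : X t) : t \in r ->
  foldr aexp g r (upd x v) = foldr aexp g r x.
Proof.
elim: r x t v => //= s r IH x t v; rewrite inE; have [ts _|ts /= tr] := eqVneq t s.
  move: v; rewrite ts => v.
  by congr (_ / _); apply: eq_bigr => u _; rewrite upd_upd.
by congr (_ / _); apply: eq_bigr => u _; rewrite updC // IH.
Qed.

(** Once every coordinate has been averaged over its anchors, the result depends on no coordinate
    and is the constant [c]. *)
Lemma anchored_poincare (g : qspace X -> R) : (forall x, 0 <= g x) ->
  exists2 c, 0 <= c & \sum_x mu x * `|g x - c| <=
    2 * alpha^-1 ^+ k * \sum_t \sum_x mu x * `|g x - cexp mu t g x|.
Proof.
move=> g0; have [x0 _] := qspace_inhabited.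
exists (foldr aexp g (enum 'I_k) x0).
  elim: (enum 'I_k) x0 => //= t r IH x0; apply: divr_ge0; last exact/ltW.
  by apply: sumr_ge0 => v _; rewrite mulr_ge0 // mass1_ge0.
have := L1_foldr_aexp g (enum 'I_k); rewrite size_enum_ord big_enum /=.
apply: le_trans; apply: ler_sum => x _; rewrite ler_wpM2l //.
rewrite (@const_of_upd _ _ _ (foldr aexp g (enum 'I_k)) _ x0 x) // => y t v.
by rewrite foldr_aexp_upd // mem_enum.
Qed.

End Poincare.

(** * Conditioning a product measure on an event *)

Section Divergence.
Variable R : realType.

Lemma ln_le_sub1 (x : R) : 0 < x -> ln x <= x - 1.
Proof.
move=> x0; have := @le_ln1Dx R (x - 1); rewrite addrCA subrr addr0; apply.
by rewrite -subr_gt0 opprK subrK.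
Qed.

Lemma ln_prod (I : finType) (F : I -> R) :
  (forall i, 0 < F i) -> ln (\prod_i F i) = \sum_i ln (F i).
Proof.
move=> F0; suff [] : 0 < \prod_i F i /\ ln (\prod_i F i) = \sum_i ln (F i) by [].
elim/big_ind2 : _ => [|a b a' b' [b0 <-] [b0' <-]|i _]; rewrite ?ltr01 ?ln1 //.
by rewrite mulr_gt0 // lnM.
Qed.

Variables (I : finType) (p q : I -> R).
Hypothesis p_ge0 : forall i, 0 <= p i.
Hypothesis q_ge0 : forall i, 0 <= q i.
Hypothesis p_sum1 : \sum_i p i = 1.
Hypothesis q_sum1 : \sum_i q i = 1.
Hypothesis p_ac : forall i, q i = 0 -> p i = 0.

(* Both sides are compared with the squared Hellinger distance
   [\sum_i (sqrt (p i) - sqrt (q i)) ^+ 2]. *)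
Lemma norm1_le_divergence :
  (\sum_i `|p i - q i|) ^+ 2 <= 4 * \sum_i p i * ln (p i / q i).
Proof.
pose a i := Num.sqrt (p i); pose b i := Num.sqrt (q i).
have pE i : p i = a i ^+ 2 by rewrite sqr_sqrtr.
have qE i : q i = b i ^+ 2 by rewrite sqr_sqrtr.
have [a0 b0] : (forall i, 0 <= a i) /\ (forall i, 0 <= b i).
  by split=> i; apply: sqrtr_ge0.
have -> : \sum_i `|p i - q i| = \sum_i `|a i - b i| * (a i + b i).
  apply: eq_bigr => i _; rewrite pE qE subr_sqr normrM [X in _ * X]ger0_norm //.
  by rewrite addr_ge0.
apply: le_trans (cauchy_schwarz_sum _ _) _.
pose S := \sum_i a i * b i.
have -> : \sum_i `|a i - b i| ^+ 2 = 2 - 2 * S.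
  rewrite (eq_bigr (fun i => p i + q i + (- 2) * (a i * b i))).
    by rewrite !big_split /= p_sum1 q_sum1 -mulr_sumr -/S; ring.
  by move=> i _; rewrite pE qE real_normK ?num_real //; ring.
have -> : \sum_i (a i + b i) ^+ 2 = 2 + 2 * S.
  rewrite (eq_bigr (fun i => p i + q i + 2 * (a i * b i))).
    by rewrite !big_split /= p_sum1 q_sum1 -mulr_sumr -/S; ring.
  by move=> i _; rewrite pE qE; ring.
(* Termwise [ln z <= z - 1] at [z = b i / a i], as [ln (p i / q i) = - 2 * ln z]. *)
have HD : 2 - 2 * S <= \sum_i p i * ln (p i / q i).
  have -> : 2 - 2 * S = \sum_i (2 * p i + (- 2) * (a i * b i)).
    by rewrite big_split /= -!mulr_sumr p_sum1 -/S; ring.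
  apply: ler_sum => i _.
  have [pi0|pi0] := eqVneq (p i) 0.
    by rewrite pi0 /a pi0 sqrtr0 !mul0r !mulr0 addr0.
  have qi0 : q i != 0 by apply: contraNneq pi0 => /p_ac ->.
  have ai0 : 0 < a i by rewrite sqrtr_gt0 lt_neqAle eq_sym pi0 p_ge0.
  have bi0 : 0 < b i by rewrite sqrtr_gt0 lt_neqAle eq_sym qi0 q_ge0.
  have r0 : 0 < b i / a i by rewrite divr_gt0.
  have -> : p i / q i = ((b i / a i) ^+ 2)^-1.
    by rewrite pE qE expr_div_n invf_div.
  rewrite lnV ?posrE ?exprn_gt0 // lnXn //.
  have := ln_le_sub1 r0; set l := ln _ => Hl.
  have := ler_wpM2l (p_ge0 i) Hl.
  have -> : p i * (b i / a i - 1) = a i * b i - p i.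
    by rewrite mulrBr mulr1 pE expr2 -mulrA [a i * (b i / _)]mulrC divfK // lt0r_neq0.
  have -> : p i * - (l *+ 2) = - 2 * (p i * l) by ring.
  by set w := p i * l; lra.
have S1 : 0 <= 2 - 2 * S.
  have -> : 2 - 2 * S = \sum_i (a i - b i) ^+ 2.
    rewrite (eq_bigr (fun i => p i + q i + (- 2) * (a i * b i))).
      by rewrite !big_split /= p_sum1 q_sum1 -mulr_sumr -/S; ring.
    by move=> i _; rewrite pE qE; ring.
  by apply: sumr_ge0 => i _; apply: sqr_ge0.
(* The other factor [2 + 2 * S] is at most 4 because [S <= 1]. *)
apply: le_trans (_ : (2 - 2 * S) * 4 <= _); last by rewrite mulrC ler_wpM2l.
by apply: ler_wpM2l => //; lra.
Qed.

End Divergence.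

Section Conditioning.
Variables (R : realType) (n : nat) (Y : 'I_n -> finType).
Variables (nu : forall j, Y j -> R) (E : pred (qspace Y)).
Hypothesis nu_ge0 : forall j v, 0 <= @nu j v.
Hypothesis nu_sum1 : forall j, \sum_v @nu j v = 1.

Let nuX (x : qspace Y) := \prod_j @nu j (x j).
Let N := \sum_(x | E x) nuX x.
Let marg j (v : Y j) := \sum_(x | E x && (x j == v)) nuX x.
Hypothesis N_gt0 : 0 < N.

Let nuX_ge0 x : 0 <= nuX x. Proof. exact: prodr_ge0. Qed.

Let marg_sum j (G : Y j -> R) : \sum_v @marg j v * G v = \sum_(x | E x) nuX x * G (x j).
Proof.
rewrite [RHS](partition_big (fun x : qspace Y => x j) predT) //=.
apply: eq_bigr => v _; rewrite /marg mulr_suml; apply: eq_bigr => x.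
by move=> /andP[_ /eqP ->].
Qed.

Let marg_ac j v : @nu j v = 0 -> @marg j v = 0.
Proof.
move=> nu0; apply: big1 => x /andP[_ /eqP xj].
by rewrite /nuX (bigD1 j) //= xj nu0 mul0r.
Qed.

(** The divergences of the marginals add up to at most [- ln N], the divergence of the conditioned
    measure from the product. *)
Lemma conditioned_product_marginals :
  \sum_j (\sum_v `|@marg j v / N - @nu j v|) ^+ 2 <= 4 * - ln N.
Proof.
have N0 : N != 0 by rewrite lt0r_neq0.
pose F j v := @marg j v / N / @nu j v.
have marg_ge0 j v : 0 <= @marg j v by apply: sumr_ge0.
have F_ge0 j v : 0 <= F j v by rewrite /F !divr_ge0 // ltW.
apply: le_trans (_ : \sum_j 4 * \sum_v (@marg j v / N) * ln (F j v) <= _).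
  apply: ler_sum => j _; apply: norm1_le_divergence => //.
  - by move=> v; rewrite divr_ge0 // ltW.
  - have := marg_sum (fun _ : Y j => N^-1); rewrite -[in RHS]mulr_suml => ->.
    by rewrite divff.
  - by move=> v /marg_ac ->; rewrite mul0r.
rewrite -mulr_sumr ler_wpM2l //.
have -> : \sum_j \sum_v @marg j v / N * ln (F j v) =
    N^-1 * \sum_(x | E x) nuX x * \sum_j ln (F j (x j)).
  under [in RHS]eq_bigr do rewrite mulr_sumr.
  rewrite exchange_big mulr_sumr; apply: eq_bigr => j _ /=.
  rewrite -(marg_sum (fun v => ln (F j v))) mulr_sumr; apply: eq_bigr => v _.
  by rewrite mulrA [N^-1 * _]mulrC.
(* [ln z <= z - 1] at [z = N * \prod_j F j (x j)], where [F j] is the density of the conditioned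
   marginal. *)
apply: le_trans (_ : N^-1 * \sum_(x | E x) nuX x * (N * \prod_j F j (x j) - 1 - ln N) <= _).
  rewrite ler_wpM2l ?invr_ge0 ?(ltW N_gt0) //; apply: ler_sum => x Ex.
  have [->|nx0] := eqVneq (nuX x) 0; first by rewrite !mul0r.
  have nx : 0 < nuX x by rewrite lt_neqAle eq_sym nx0 nuX_ge0.
  rewrite ler_wpM2l //.
  have Fx j : 0 < F j (x j).
    rewrite /F !divr_gt0 //.
      rewrite /marg (bigD1 x) ?Ex ?eqxx //=.
      by rewrite ltr_pwDl // sumr_ge0.
    rewrite lt_neqAle nu_ge0 andbT eq_sym; apply: contraNneq nx0 => z.
    by rewrite /nuX (bigD1 j) //= z mul0r.
  have P0 : 0 < \prod_j F j (x j) by apply: prodr_gt0.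
  have := ln_le_sub1 (mulr_gt0 N_gt0 P0); rewrite lnM // ln_prod //.
  by lra.
under eq_bigr do rewrite -addrA mulrDr mulrCA.
rewrite big_split /= -mulr_sumr -mulr_suml -/N mulrDr !mulKf //.
(* Without the restriction to [E] the sum is a product over [j] of sums of [nu j v * F j v], each
   equal to 1. *)
suff : \sum_(x | E x) nuX x * \prod_j F j (x j) <= 1 by lra.
apply: le_trans (_ : \sum_x nuX x * \prod_j F j (x j) <= _).
  by apply: ler_sum_imp => // x; rewrite mulr_ge0 // prodr_ge0.
under eq_bigr do rewrite /nuX -big_split /=.
rewrite (sum_prod_distr (fun j v => @nu j v * F j v)) big1 // => j _.
rewrite (eq_bigr (fun v => @marg j v * N^-1)); last first.
  move=> v _; rewrite /F; have [z|z] := eqVneq (@nu j v) 0.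
    by rewrite marg_ac // z !mul0r.
  by rewrite mulrC divfK.
by rewrite (marg_sum (fun _ => N^-1)) -mulr_suml divff.
Qed.

End Conditioning.

Section AveragedConditioning.
Variables (R : realType) (I Q : finType) (n : nat) (M : R).
Variables (w : I -> R) (nu : I -> 'I_n -> Q -> R).
Variable E : I -> pred (qspace (fun _ : 'I_n => Q)).
Hypothesis w_ge0 : forall i, 0 <= w i.
Hypothesis w_sum : \sum_i w i <= M.
Hypothesis nu_ge0 : forall i j v, 0 <= nu i j v.
Hypothesis nu_sum1 : forall i, w i != 0 -> forall j, \sum_v nu i j v = 1.

Let nuX i (x : qspace (fun _ : 'I_n => Q)) := \prod_j nu i j (x j).
Let N i := \sum_(x | E i x) nuX i x.
Let marg i j v := \sum_(x | E i x && (x j == v)) nuX i x.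
Let P := \sum_i w i * N i.
Hypothesis P_gt0 : 0 < P.

Let N_ge0 i : 0 <= N i.
Proof. by apply: sumr_ge0 => x _; apply: prodr_ge0. Qed.

(* Jensen's inequality for [ln], in the form [ln t <= t - 1] at
   [t = P / (M * N i)]. *)
Lemma averaged_entropy_le : \sum_i w i * N i * - ln (N i) <= P * ln (M / P).
Proof.
have M_gt0 : 0 < M.
  rewrite ltNge; apply/negP => M0; move: P_gt0; rewrite ltNge => /negP; apply.
  apply: sumr_le0 => i _.
  have /eqP : \sum_i w i = 0.
    by apply/eqP; rewrite eq_le (le_trans w_sum M0) sumr_ge0.
  rewrite psumr_eq0 // => /allP/(_ i); rewrite mem_index_enum => /(_ isT)/eqP ->.
  by rewrite mul0r.
apply: le_trans (_ : \sum_i w i * (N i * ln (M / P) + (P / M - N i)) <= _).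
  apply: ler_sum => i _; rewrite -mulrA ler_wpM2l //.
  have [Ni0|Ni0] := eqVneq (N i) 0.
    by rewrite Ni0 !mul0r add0r subr0 divr_ge0 ?ltW.
  have Ni : 0 < N i by rewrite lt_neqAle eq_sym Ni0 N_ge0.
  have t0 : 0 < (M / P)^-1 * (N i)^-1 by rewrite mulr_gt0 ?invr_gt0 ?divr_gt0.
  have lnE : ln ((M / P)^-1 * (N i)^-1) = - ln (M / P) - ln (N i).
    by rewrite [LHS]lnM ?posrE ?invr_gt0 ?divr_gt0 // !lnV ?posrE ?divr_gt0.
  have := ln_le_sub1 t0; rewrite lnE.
  move=> /(ler_wpM2l (N_ge0 i)).
  have -> : N i * ((M / P)^-1 * (N i)^-1 - 1) = P / M - N i.
    by rewrite mulrBr mulr1 mulrCA divff // mulr1 invf_div.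
  by rewrite mulrDr !mulrN; lra.
under eq_bigr do rewrite mulrDr mulrBr mulrA.
rewrite big_split sumrB /= -!mulr_suml -/P.
suff : (\sum_i w i) * (P / M) <= P by lra.
rewrite mulrA ler_pdivrMr // mulrC; apply: ler_wpM2l => //; exact/ltW.
Qed.

(** Cauchy-Schwarz with the weights [w i * N i], of total [P], moves the square inside; the bound
    for each [i] and [averaged_entropy_le] then apply. *)
Lemma averaged_marginals :
  \sum_j (\sum_i w i * \sum_v `|marg i j v - N i * nu i j v|) ^+ 2 <=
  4 * P ^+ 2 * ln (M / P).
Proof.
pose d i j := \sum_v `|marg i j v / N i - nu i j v|.
have marg0 i j v : N i = 0 -> marg i j v = 0.
  move=> /eqP; rewrite psumr_eq0; last by move=> x _; apply: prodr_ge0.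
  move=> /allP H; apply: big1 => x /andP[Ex _].
  by have := H x; rewrite mem_index_enum Ex => /(_ isT)/eqP.
have dE i j : \sum_v `|marg i j v - N i * nu i j v| = N i * d i j.
  rewrite mulr_sumr; apply: eq_bigr => v _.
  have [Ni|Ni] := eqVneq (N i) 0; first by rewrite marg0 // Ni !mul0r subr0 normr0.
  by rewrite -{2}(ger0_norm (N_ge0 i)) -normrM mulrBr mulrCA divff // mulr1.
apply: le_trans (_ : \sum_j P * (\sum_i w i * N i * d i j ^+ 2) <= _).
  apply: ler_sum => j _; under eq_bigr do rewrite dE mulrA.
  pose a i := Num.sqrt (w i * N i).
  have aE i : a i ^+ 2 = w i * N i by rewrite sqr_sqrtr // mulr_ge0.
  have -> : P = \sum_i a i ^+ 2 by apply: eq_bigr => i _; rewrite aE.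
  rewrite [X in _ <= _ * X](eq_bigr (fun i => (a i * d i j) ^+ 2)); last first.
    by move=> i _; rewrite exprMn aE.
  rewrite [X in X ^+ 2](eq_bigr (fun i => a i * (a i * d i j))); last first.
    by move=> i _; rewrite mulrA -expr2 aE.
  exact: cauchy_schwarz_sum.
rewrite -mulr_sumr (_ : 4 * _ * _ = P * (4 * (P * ln (M / P)))); last by ring.
rewrite ler_pM2l //.
rewrite exchange_big /=.
apply: le_trans (_ : \sum_i 4 * (w i * N i * - ln (N i)) <= _).
  apply: ler_sum => i _; rewrite -mulr_sumr mulrCA.
  have [->|wi] := eqVneq (w i) 0; first by rewrite !mul0r.
  have [->|Ni] := eqVneq (N i) 0; first by rewrite mulr0 !mul0r.
  rewrite ler_wpM2l //; first by rewrite mulr_ge0.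
  by apply: conditioned_product_marginals; [|exact: nu_sum1|rewrite lt_neqAle eq_sym Ni N_ge0].
by rewrite -mulr_sumr ler_wpM2l // averaged_entropy_le.
Qed.

End AveragedConditioning.

(** * Randomised strategies *)

(** The values of a random [h] are drawn independently, and all factors but that of [u0] sum to
    1. *)
Lemma sum_ffun_eval (R : realType) (U B : finType) (p : U -> B -> R) u0 b :
  (forall u, \sum_c p u c = 1) ->
  \sum_(h : {ffun U -> B}) (h u0 == b)%:R * \prod_u p u (h u) = p u0 b.
Proof.
move=> p1; pose F u c : R := ((u == u0) ==> (c == b))%:R * p u c.
transitivity (\sum_(h : {ffun U -> B}) \prod_u F u (h u)).
  apply: eq_bigr => h _; rewrite /F big_split /=; congr (_ * _).
  rewrite (bigD1 u0) //= eqxx big1 ?mulr1 // => u /negbTE -> //.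
rewrite -bigA_distr_bigA (bigD1 u0) //= [X in _ * X]big1 ?mulr1; last first.
  by move=> u /negbTE u0N; rewrite -[RHS](p1 u); apply: eq_bigr => c _; rewrite /F u0N mul1r.
rewrite (bigD1 b) //= /F !eqxx big1 ?addr0 ?mul1r // => c /negbTE ->.
by rewrite mul0r.
Qed.

Section Strategies.
Variables (R : realType) (k : nat) (X A : 'I_k -> finType).
Variables (mu : qspace X -> R) (V : qspace X -> qspace A -> bool).

Lemma win_prob_le (f : strategy X A) : win_prob mu V f <= game_val mu V.
Proof. exact: le_bigmax. Qed.

Section Derandomize.
Variable p : forall s, X s -> A s -> R.
Hypothesis p_ge0 : forall s u b, 0 <= @p s u b.
Hypothesis p_sum1 : forall s u, \sum_b @p s u b = 1.

Definition rand_win (v : qspace X) : R :=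
  \sum_(b : qspace A) (V v b)%:R * \prod_s p (v s) (b s).

Lemma rand_win01 v : 0 <= rand_win v <= 1.
Proof.
apply/andP; split.
  by apply: sumr_ge0 => b _; rewrite mulr_ge0 // prodr_ge0.
apply: le_trans (_ : \sum_(b : qspace A) \prod_s p (v s) (b s) <= _).
  apply: ler_sum => b _; apply: ler_piMl; first by apply: prodr_ge0.
  by rewrite lern1 leq_b1.
by rewrite (sum_prod_distr (fun s b => p (v s) b)) big1.
Qed.

Let wt (h : strategy X A) : R := \prod_s \prod_(u : X s) p u (h s u).

Let wt_sum1 : \sum_h wt h = 1.
Proof.
rewrite (sum_prod_distr (fun s (f : {ffun X s -> A s}) => \prod_u p u (f u))).
by rewrite big1 // => s _; rewrite -(bigA_distr_bigA (@p s)) big1.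
Qed.

(** Drawing every player's whole answer table in advance, with probability [wt], gives a mixture of
    deterministic strategies. *)
Lemma rand_win_le : \sum_v mu v * rand_win v <= game_val mu V.
Proof.
have H v : rand_win v = \sum_h wt h * (V v (answers_of h v))%:R.
  rewrite (partition_big (fun h => answers_of h v) predT) //=.
  apply: eq_bigr => b _.
  rewrite (eq_bigr (fun h => (V v b)%:R * wt h)) => [|h /eqP ->]; last by rewrite mulrC.
  rewrite -mulr_sumr; congr (_ * _); rewrite [RHS]big_mkcond /=.
  rewrite (eq_bigr (fun h : strategy X A =>
      \prod_s ((h s (v s) == b s)%:R * \prod_(u : X s) p u (h s u)))); last first.
    move=> h _; rewrite big_split /= -/(wt h) prodr_natb.
    have -> : [forall s, h s (v s) == b s] = (answers_of h v == b).
      apply/forallP/eqP => [E|<- s]; last by rewrite ffunE.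
      by apply/ffunP => s; rewrite ffunE (eqP (E s)).
    by case: ifP; rewrite ?mul1r ?mul0r.
  rewrite (sum_prod_distr (fun s (f : {ffun X s -> A s}) =>
     (f (v s) == b s)%:R * \prod_u p u (f u))).
  by apply: eq_bigr => s _; rewrite sum_ffun_eval.
rewrite -[X in _ <= X]mul1r -wt_sum1 mulr_suml.
under eq_bigr do rewrite H mulr_sumr.
rewrite exchange_big /=; apply: ler_sum => h _.
have wt0 : 0 <= wt h by apply: prodr_ge0 => s _; apply: prodr_ge0.
apply: le_trans (ler_wpM2l wt0 (win_prob_le h)).
by rewrite /win_prob mulr_sumr; apply: ler_sum => v _; rewrite mulrCA.
Qed.

End Derandomize.

(* Each player samples an [n]-fold question from its own factor of the product
   weight [Phi] and answers with coordinate [i] of the repeated strategy. *)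
Lemma product_strategy (n : nat) (f : strategy (repT n X) (repT n A)) (i : 'I_n)
    (Phi : forall s, X s -> repT n X s -> R) (a0 : qspace A) :
  (forall s u z, 0 <= @Phi s u z) ->
  exists w : qspace X -> R, [/\ forall v, 0 <= w v <= 1,
    forall v, \sum_(z : qspace (repT n X))
        (V v (round (answers_of f z) i))%:R * \prod_s Phi s (v s) (z s) =
      w v * \sum_(z : qspace (repT n X)) \prod_s Phi s (v s) (z s)
    & \sum_v mu v * w v <= game_val mu V].
Proof.
move=> Phi0; pose N s u := \sum_(z : repT n X s) Phi s u z.
have N0 s u : 0 <= N s u by apply: sumr_ge0.
pose q s (u : X s) (b : A s) : R := \sum_(z : repT n X s | f s z i == b) Phi s u z.
have qN s u : \sum_b q s u b = N s u.
  by rewrite /N (partition_big (fun z : repT n X s => f s z i) predT).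
have q0 s u b : 0 <= q s u b by apply: sumr_ge0.
(* A player whose factor has total weight 0 answers [a0 s]; [q] vanishes there, so [Np] still
   holds. *)
pose p s (u : X s) (b : A s) : R :=
  if N s u == 0 then (b == a0 s)%:R else q s u b / N s u.
have p0 s u b : 0 <= p s u b by rewrite /p; case: ifP => // _; rewrite divr_ge0.
have p1 s u : \sum_b p s u b = 1.
  rewrite /p; case: eqVneq => [_|Nn]; last by rewrite -mulr_suml qN divff.
  by rewrite (bigD1 (a0 s)) //= eqxx big1 ?addr0 // => b /negbTE ->.
have Np s u b : N s u * p s u b = q s u b.
  rewrite /p; case: eqVneq => [Nz|Nn]; last by rewrite mulrC divfK.
  rewrite Nz mul0r; apply/esym/eqP; move: (qN s u); rewrite Nz => /eqP.
  by rewrite psumr_eq0 // => /allP/(_ b); rewrite mem_index_enum => /(_ isT).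
exists (rand_win p); split; [exact: rand_win01| |exact: rand_win_le].
move=> v; rewrite (sum_prod_distr (fun s z => Phi s (v s) z)).
rewrite (partition_big (fun z => round (answers_of f z) i) predT) //=.
rewrite /rand_win mulr_suml; apply: eq_bigr => b _.
rewrite (eq_bigr (fun z : qspace (repT n X) => (V v b)%:R * \prod_s Phi s (v s) (z s)));
  last by move=> z /eqP ->.
rewrite -mulr_sumr -mulrA; congr (_ * _); rewrite -big_split /=.
under [RHS]eq_bigr => s _ do rewrite mulrC -/(N s (v s)) Np /q big_mkcond /=.
rewrite -(sum_prod_distr (fun s z => if f s z i == b s then Phi s (v s) z else 0)).
rewrite big_mkcond; apply: eq_bigr => z _ /=.
case: eqP => [<-|ne].
  by apply: eq_bigr => s _; rewrite !ffunE eqxx.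
have /existsP[s sne] : [exists s, f s (z s) i != b s].
  rewrite -negb_forall; apply/negP => /forallP E; apply: ne.
  by apply/ffunP => s; rewrite !ffunE (eqP (E s)).
by rewrite (bigD1 s) //= (negbTE sne) mul0r.
Qed.

End Strategies.

(** * Resampling one coordinate *)

(** The Gibbs sampler kernel from [y] to [x] at coordinate [t]. *)
Definition resample (R : realType) (k : nat) (X : 'I_k -> finType)
    (mu : qspace X -> R) t (y x : qspace X) : R :=
  (offeq t y x)%:R * mu x / off_marg mu t y.

Section Resample.
Variables (R : realType) (k : nat) (X : 'I_k -> finType) (mu : qspace X -> R).
Hypothesis mu_ge0 : forall x, 0 <= mu x.

Lemma off_marg_ge0 t x : 0 <= off_marg mu t x.
Proof. exact: sumr_ge0. Qed.

Lemma off_marg_gt0 t x : mu x != 0 -> 0 < off_marg mu t x.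
Proof.
move=> mx; rewrite /off_marg (bigD1 (x t)) //= upd_id ltr_pwDl ?sumr_ge0 //.
by rewrite lt_neqAle eq_sym mx mu_ge0.
Qed.

Lemma offeq_off_marg t y x : offeq t y x -> off_marg mu t x = off_marg mu t y.
Proof. by move=> /offeqP ->; rewrite off_marg_upd. Qed.

Lemma resample_ge0 t y x : 0 <= resample mu t y x.
Proof. by rewrite /resample !mulr_ge0 ?invr_ge0 // off_marg_ge0. Qed.

Lemma resample_cexp t y g : \sum_x resample mu t y x * g x = cexp mu t g y.
Proof.
rewrite /cexp -(sum_offeq t y (fun x => mu x * g x)) mulr_suml [RHS]big_mkcond /=.
apply: eq_bigr => x _.
by rewrite /resample; case: ifP => _; rewrite ?mul1r ?mul0r // mulrAC.
Qed.

Lemma resample_sum1 t y : mu y != 0 -> \sum_x resample mu t y x = 1.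
Proof.
move=> my; have := resample_cexp t y (fun=> 1); rewrite /cexp.
under eq_bigr do rewrite mulr1; under [X in _ = X / _]eq_bigr do rewrite mulr1.
by move=> ->; rewrite divff // lt0r_neq0 // off_marg_gt0.
Qed.

Lemma resample_stationary t x : \sum_y mu y * resample mu t y x = mu x.
Proof.
have [mx|mx] := eqVneq (mu x) 0.
  by rewrite mx big1 // => y _; rewrite /resample mx mulr0 mul0r mulr0.
transitivity (\sum_(y | offeq t x y) mu y * (mu x / off_marg mu t x)).
  rewrite [RHS]big_mkcond /=; apply: eq_bigr => y _; rewrite /resample offeq_sym.
  case: ifP => [h|_]; last by rewrite !mul0r mulr0.
  by rewrite mul1r -(offeq_off_marg h).
rewrite -mulr_suml sum_offeq -/(off_marg mu t x) mulrC divfK //.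
by rewrite lt0r_neq0 // off_marg_gt0.
Qed.

(** Each factor involves one player only, which makes the players' questions independent given a
    hint. *)
Lemma resample_prod t y x : resample mu t y x =
  \prod_s (if s == t then mu (upd y (x s)) / off_marg mu s y else (x s == y s)%:R).
Proof.
rewrite (bigD1 t) //= eqxx (eq_bigr (fun s => (y s == x s)%:R)); last first.
  by move=> s /negbTE ->; rewrite eq_sym.
rewrite prodr_natb -/(offeq t y x) /resample.
case: (offeqP t y x) => [xE|_]; last by rewrite mulr0 !mul0r.
by rewrite -xE mul1r mulr1.
Qed.

(** [cexp mu t g] agrees at [y] and at the resampled [v], so stationarity sums out [y]. *)
Lemma resample_deviation t (g : qspace X -> R) :
  \sum_y mu y * \sum_v resample mu t y v * `|g v - cexp mu t g y| =
  \sum_v mu v * `|g v - cexp mu t g v|.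
Proof.
under eq_bigr do rewrite mulr_sumr.
rewrite exchange_big /=; apply: eq_bigr => v _.
rewrite -[in RHS](resample_stationary t v) mulr_suml; apply: eq_bigr => y _.
rewrite mulrA; have [/offeqP ->|/negbTE h] := boolP (offeq t y v).
  by rewrite cexp_upd.
by rewrite /resample h !mul0r mulr0 !mul0r.
Qed.

End Resample.

(** * Conditioning on winning some rounds *)

(** Indexed by round first, so that the independent rounds are the coordinates; [unround] restores
    the order by player that strategies expect. *)
Definition rounds (k n : nat) (X : 'I_k -> finType) : finType :=
  qspace (fun _ : 'I_n => qspace X).

Definition unround (k n : nat) (X : 'I_k -> finType) (x : rounds n X) :
    qspace (repT n X) :=
  [ffun s => [ffun j => x j s] : repT n X s].

Lemma unroundE (k n : nat) (X : 'I_k -> finType) (x : rounds n X) s j :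
  unround x s j = x j s.
Proof. by rewrite !ffunE. Qed.

Lemma round_unround (k n : nat) (X : 'I_k -> finType) (x : rounds n X) j :
  round (unround x) j = x j.
Proof. by apply/ffunP => s; rewrite ffunE unroundE. Qed.

Lemma unround_bij (k n : nat) (X : 'I_k -> finType) : bijective (@unround k n X).
Proof.
exists (fun z => [ffun j => round z j]) => z.
  by apply/ffunP => j; rewrite ffunE round_unround.
by apply/ffunP => s; apply/ffunP => j; rewrite unroundE !ffunE.
Qed.

Section WinningRounds.
Variables (R : realType) (k n m : nat) (X A : 'I_k -> finType).
Variables (mu : qspace X -> R) (V : qspace X -> qspace A -> bool).
Variables (f : strategy (repT n X) (repT n A)) (c : 'I_m -> 'I_n).
Hypothesis mu_ge0 : forall x, 0 <= mu x.
Hypothesis mu_sum1 : \sum_x mu x = 1.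
Hypothesis k_gt0 : (0 < k)%N.

Definition answer (x : rounds n X) (j : 'I_n) : qspace A :=
  round (answers_of f (unround x)) j.

Lemma answerE x j s : answer x j s = f s (unround x s) j.
Proof. by rewrite !ffunE. Qed.

Definition win (x : rounds n X) (j : 'I_n) : bool := V (x j) (answer x j).

Definition wins (x : rounds n X) : bool := [forall l, win x (c l)].

Definition wins_prob (u : rounds n X -> R) : R :=
  \sum_(x : rounds n X) (\prod_j mu (x j)) * (wins x)%:R * u x.

Definition inC j := [exists l, c l == j].

(* A hint for round [j] is a player [t] and a question tuple [y] whose [t]-th
   coordinate is then resampled; the rounds in the image of [c] are revealed
   completely. *)
Definition hint : finType := ('I_k * qspace X)%type.
Definition hints : finType := qspace (fun _ : 'I_n => hint).

Definition prior (h : hint) : R := k%:R^-1 * mu h.2.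

Definition ker j (h : hint) (x : qspace X) : R :=
  if inC j then (x == h.2)%:R else resample mu h.1 h.2 x.

Definition labels : finType := {ffun 'I_m -> qspace A}.
Definition label (x : rounds n X) : labels := [ffun l => answer x (c l)].

Definition good (h : hints) (a : labels) := [forall l, V (h (c l)).2 (a l)].

(** Not a probability: labels are counted without weight, whence the factor [#|labels|] in
    [weight_sum]. *)
Definition weight (p : hints * labels) : R :=
  (\prod_j prior (p.1 j)) * (good p.1 p.2)%:R.

Definition kerX (h : hints) (x : rounds n X) : R := \prod_j ker j (h j) (x j).

Let k_neq0 : k%:R != 0 :> R. Proof. by rewrite pnatr_eq0 -lt0n. Qed.

Lemma prior_ge0 h : 0 <= prior h.
Proof. by rewrite mulr_ge0 // invr_ge0. Qed.

Lemma ker_ge0 j h x : 0 <= ker j h x.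
Proof. by rewrite /ker; case: ifP => // _; apply: resample_ge0. Qed.

Lemma weight_ge0 p : 0 <= weight p.
Proof. by rewrite mulr_ge0 // prodr_ge0 // => j _; apply: prior_ge0. Qed.

Lemma sum_hint (F : hint -> R) : \sum_h F h = \sum_t \sum_y F (t, y).
Proof. by rewrite pair_bigA; apply: eq_bigr => -[]. Qed.

Lemma prior_sum1 : \sum_h prior h = 1.
Proof.
rewrite sum_hint /prior /= (eq_bigr (fun=> k%:R^-1)).
  by rewrite sumr_const card_ord -[LHS]mulr_natl divff.
by move=> t _; rewrite -mulr_sumr mu_sum1 mulr1.
Qed.

(** By stationarity, hints can be introduced without changing the law of a round. *)
Lemma prior_ker j x : \sum_h prior h * ker j h x = mu x.
Proof.
rewrite sum_hint (eq_bigr (fun=> k%:R^-1 * mu x)).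
  by rewrite sumr_const card_ord -[LHS]mulr_natl mulrA divff // mul1r.
move=> t _; rewrite /prior /ker /=; case: (inC j).
  rewrite (bigD1 x) //= eqxx mulr1 big1 ?addr0 // => y /negbTE.
  by rewrite eq_sym => ->; rewrite mulr0.
under eq_bigr do rewrite -mulrA; by rewrite -mulr_sumr resample_stationary.
Qed.

Lemma ker_sum1 j h : mu h.2 != 0 -> \sum_x ker j h x = 1.
Proof.
move=> mh; rewrite /ker; case: (inC j); last exact: resample_sum1.
by rewrite (bigD1 h.2) //= eqxx big1 ?addr0 // => x /negbTE ->.
Qed.

Lemma weight_sum : \sum_p weight p <= #|labels|%:R.
Proof.
rewrite (eq_bigr (fun p : hints * labels => weight (p.1, p.2))); last by case.
rewrite -(pair_bigA _ (fun h a => weight (h, a))) /=.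
apply: le_trans (_ : \sum_(h : hints) (\prod_j prior (h j)) * #|labels|%:R <= _).
  apply: ler_sum => h _; rewrite mulr_natr -sumr_const; apply: ler_sum => a _.
  rewrite /weight /= ler_piMr ?lern1 ?leq_b1 //.
  by apply: prodr_ge0 => j _; apply: prior_ge0.
rewrite -mulr_suml (sum_prod_distr (fun (_ : 'I_n) (h : hint) => prior h)).
by rewrite big1 ?mul1r // => j _; apply: prior_sum1.
Qed.

Lemma kerX_good h x : kerX h x != 0 -> good h (label x) = wins x.
Proof.
move=> h0; apply: eq_forallb => l; rewrite ffunE /win.
suff -> : x (c l) = (h (c l)).2 by [].
apply/eqP; apply: contraNT h0 => /negbTE ne; apply/eqP.
rewrite /kerX (bigD1 (c l)) //= /ker (_ : inC (c l)) ?ne ?mul0r //.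
by apply/existsP; exists l.
Qed.

(** Hints and label decide whether the rounds of [c] are won ([kerX_good]), and [prior_ker] sums out
    the hints round by round. *)
Lemma weight_wins_prob (u : rounds n X -> R) :
  \sum_p weight p * (\sum_(x | label x == p.2) kerX p.1 x * u x) = wins_prob u.
Proof.
transitivity (\sum_(h : hints) \sum_(x : rounds n X)
    (\prod_j prior (h j)) * (good h (label x))%:R * (kerX h x * u x)).
  rewrite (eq_bigr (fun p : hints * labels => weight (p.1, p.2) *
    (\sum_(x | label x == p.2) kerX p.1 x * u x))); last by case.
  rewrite -(pair_bigA _ (fun h a => weight (h, a) *
    (\sum_(x | label x == a) kerX h x * u x))) /=.
  apply: eq_bigr => h _; rewrite [RHS](partition_big label predT) //=.
  apply: eq_bigr => a _; rewrite mulr_sumr; apply: eq_bigr => x /eqP <-.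
  by [].
rewrite exchange_big /=; apply: eq_bigr => x _.
rewrite (eq_bigr (fun h : hints => (\prod_j (prior (h j) * ker j (h j) (x j))) *
    ((wins x)%:R * u x))); last first.
  move=> h _; rewrite [in RHS]big_split /= -/(kerX h x).
  have [->|h0] := eqVneq (kerX h x) 0; first by rewrite !(mul0r, mulr0).
  by rewrite kerX_good //; ring.
rewrite -mulr_suml (sum_prod_distr (fun j (h : hint) => prior h * ker j h (x j))).
by rewrite mulrA; congr (_ * _ * _); apply: eq_bigr => j _; apply: prior_ker.
Qed.

Definition deviation j : R :=
  \sum_p weight p * \sum_v `|(\sum_(x | (label x == p.2) && (x j == v)) kerX p.1 x) -
    (\sum_(x | label x == p.2) kerX p.1 x) * ker j (p.1 j) v|.

Lemma deviation_sq : 0 < wins_prob (fun=> 1) ->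
  \sum_j deviation j ^+ 2 <=
  4 * wins_prob (fun=> 1) ^+ 2 * ln (#|labels|%:R / wins_prob (fun=> 1)).
Proof.
have <- : \sum_p weight p * (\sum_(x | label x == p.2) kerX p.1 x) = wins_prob (fun=> 1).
  rewrite -weight_wins_prob; apply: eq_bigr => p _; congr (_ * _).
  by apply: eq_bigr => x _; rewrite mulr1.
move=> P0; apply: (averaged_marginals (I := (hints * labels)%type)
  (nu := fun p j => ker j (p.1 j)) (E := fun p x => label x == p.2)) => //.
- exact: weight_ge0.
- exact: weight_sum.
- by move=> *; apply: ker_ge0.
- move=> p wp j; apply: ker_sum1; apply: contraNneq wp => z.
  by rewrite /weight (bigD1 j) //= /prior z mulr0 !mul0r.
Qed.

(** * Isolating one round outside the image of [c] *)

Section OneMoreRound.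
Variables (i : 'I_n) (i_notin : ~~ inC i) (h0 : hint).

Definition set_hint (h : hints) (t : hint) : hints := @upd n (fun=> hint) h i t.

Definition weight' (h : hints) (a : labels) : R :=
  (\prod_(j | j != i) prior (h j)) * (good h a)%:R.

Definition kerX' (h : hints) (x : rounds n X) : R :=
  \prod_(j | j != i) ker j (h j) (x j).

(** At [u = 1], the weight of the rest of the experiment as a function of the question [v] of round
    [i]; the kernel of round [i] is left out. *)
Definition slice (u : rounds n X -> R) (h : hints) (a : labels) (v : qspace X) : R :=
  \sum_(x | (label x == a) && (x i == v)) kerX' h x * u x.

Lemma weight'_ge0 h a : 0 <= weight' h a.
Proof. by rewrite mulr_ge0 // prodr_ge0 // => j _; apply: prior_ge0. Qed.

Lemma weight_set_hint h a (t : hint) : weight (set_hint h t, a) = prior t * weight' h a.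
Proof.
rewrite /weight /weight' (bigD1 i) //= upd_in -mulrA; congr (_ * (_ * _)).
  by apply: eq_bigr => j ji; rewrite upd_out.
congr (nat_of_bool _)%:R; apply: eq_forallb => l; rewrite upd_out //.
by apply: contraNneq i_notin => <-; apply/existsP; exists l.
Qed.

Lemma kerX_set_hint h x (t : hint) : kerX (set_hint h t) x = ker i t (x i) * kerX' h x.
Proof.
rewrite /kerX (bigD1 i) //= upd_in; congr (_ * _).
by apply: eq_bigr => j ji; rewrite upd_out.
Qed.

(** Separates the hint of round [i] from the others; [h0] is a dummy held in its place. *)
Lemma sum_weight (H : hints * labels -> R) :
  \sum_p weight p * H p =
  \sum_(h : hints | h i == h0) \sum_a weight' h a * \sum_(t : hint) prior t * H (set_hint h t, a).
Proof.
rewrite (eq_bigr (fun p : hints * labels => weight (p.1, p.2) * H (p.1, p.2))); last by case.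
rewrite -(pair_bigA _ (fun h a => weight (h, a) * H (h, a))) /=.
rewrite (@sum_upd n (fun=> hint) R i h0); apply: eq_bigr => h _.
rewrite exchange_big /=; apply: eq_bigr => a _; rewrite mulr_sumr.
by apply: eq_bigr => t _; rewrite -/(set_hint h t) weight_set_hint -mulrA mulrCA.
Qed.

Lemma wins_prob_slice u : wins_prob u =
  \sum_(h : hints | h i == h0) \sum_a weight' h a * \sum_v mu v * slice u h a v.
Proof.
rewrite -weight_wins_prob sum_weight; apply: eq_bigr => h _; apply: eq_bigr => a _.
congr (_ * _) => /=.
under eq_bigr => t _.
  under eq_bigr do rewrite kerX_set_hint.
  rewrite mulr_sumr.
  over.
rewrite exchange_big /= (partition_big (fun x : rounds n X => x i) predT) //=.
apply: eq_bigr => v _; rewrite mulr_sumr; apply: eq_bigr => x /andP[_ /eqP xv].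
rewrite -(prior_ker i v) mulr_suml; apply: eq_bigr => t _.
by rewrite xv -!mulrA.
Qed.

Lemma slice_ge0 u h a v : (forall x, 0 <= u x) -> 0 <= slice u h a v.
Proof.
move=> u0; apply: sumr_ge0 => x _; rewrite mulr_ge0 //.
by apply: prodr_ge0 => j _; apply: ker_ge0.
Qed.

(** For the hint [(t, y)] the event [x i = v] has mass [resample mu t y v * g v], with total
    [cexp mu t g y]; [resample_deviation] averages over [y], and [k] cancels the uniform choice of
    [t]. *)
Lemma deviation_slice : k%:R * deviation i =
  \sum_(h : hints | h i == h0) \sum_a weight' h a *
    \sum_t \sum_v mu v * `|slice (fun=> 1) h a v - cexp mu t (slice (fun=> 1) h a) v|.
Proof.
rewrite /deviation sum_weight mulr_sumr; apply: eq_bigr => h _.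
rewrite mulr_sumr; apply: eq_bigr => a _; rewrite mulrCA; congr (_ * _).
rewrite sum_hint mulr_sumr; apply: eq_bigr => t _ /=.
set g := slice (fun=> 1) h a.
rewrite -resample_deviation // mulr_sumr; apply: eq_bigr => y _.
rewrite /prior /= mulrA mulrA divff // mul1r; congr (_ * _); apply: eq_bigr => v _.
have kerE w : ker i (t, y) w = resample mu t y w by rewrite /ker (negbTE i_notin).
have margE w : \sum_(x | (label x == a) && (x i == w)) kerX (set_hint h (t, y)) x =
    resample mu t y w * g w.
  rewrite mulr_sumr; apply: eq_bigr => x /andP[_ /eqP xw].
  by rewrite kerX_set_hint xw kerE mulr1.
rewrite margE upd_in kerE (_ : \sum_(_ | _) _ = cexp mu t g y).
  rewrite [X in _ - X]mulrC -mulrBr normrM ger0_norm //; exact: resample_ge0.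
rewrite -resample_cexp (partition_big (fun x : rounds n X => x i) predT) //=.
by apply: eq_bigr => w _; rewrite margE.
Qed.

(* Given the hints, the questions of different players are independent, also
   after fixing the label, since each player's answers depend on its own
   questions only. *)
Lemma slice_strategy (a0 : qspace A) h a :
  exists w : qspace X -> R, [/\ forall v, 0 <= w v <= 1,
    forall v, slice (fun x => (win x i)%:R) h a v = w v * slice (fun=> 1) h a v
    & \sum_v mu v * w v <= game_val mu V].
Proof.
pose phi j s (u : X s) : R := if inC j then (u == (h j).2 s)%:R else
  if s == (h j).1 then mu (upd (h j).2 u) / off_marg mu s (h j).2
  else (u == (h j).2 s)%:R.
have phiE j x : ker j (h j) x = \prod_s phi j s (x s).
  rewrite /ker /phi; case: (inC j); last exact: resample_prod.
  by rewrite prodr_qspace_eq.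
have phi0 j s u : 0 <= phi j s u.
  by rewrite /phi; do 2 case: ifP => // _; rewrite divr_ge0 // off_marg_ge0.
(* Player [s] checks locally that its question in round [i] is [u] and that its answers in the
   rounds of [c] match [a]; [phi] is its factor of the kernels. *)
pose Phi s (u : X s) (z : repT n X s) : R :=
  (z i == u)%:R * (\prod_l (f s z (c l) == a l s)%:R * \prod_(j | j != i) phi j s (z j)).
have Phi0 s u z : 0 <= Phi s u z.
  by rewrite /Phi !mulr_ge0 // prodr_ge0.
have PhiE (v : qspace X) (x : rounds n X) : \prod_s Phi s (v s) (unround x s) =
    ((label x == a) && (x i == v))%:R * kerX' h x.
  rewrite /Phi !big_split /=.
  have -> : \prod_s ((unround x s i == v s)%:R : R) = (x i == v)%:R.
    by rewrite -prodr_qspace_eq; apply: eq_bigr => s _; rewrite unroundE.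
  have -> : \prod_s \prod_l ((f s (unround x s) (c l) == a l s)%:R : R) = (label x == a)%:R.
    rewrite exchange_big (eq_bigr (fun l => (answer x (c l) == a l)%:R)) /=; last first.
      by move=> l _; rewrite -prodr_qspace_eq; apply: eq_bigr => s _; rewrite answerE.
    rewrite prodr_natb; suff -> : (label x == a) = [forall l, answer x (c l) == a l] by [].
    apply/eqP/forallP => [<- l|E]; first by rewrite ffunE.
    by apply/ffunP => l; rewrite ffunE (eqP (E l)).
  have -> : \prod_s \prod_(j | j != i) phi j s (unround x s j) = kerX' h x.
    rewrite exchange_big; apply: eq_bigr => j _; rewrite phiE.
    by apply: eq_bigr => s _; rewrite unroundE.
  by rewrite -mulnb natrM; ring.
have [w [w01 wE wV]] := product_strategy mu V f i a0 Phi0.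
have bij : {on [pred z | true], bijective (@unround k n X)} by apply/onW_bij/unround_bij.
exists w; split => // v; have := wE v.
rewrite (reindex _ bij) [X in w v * X](reindex _ bij) /= => H.
have -> : slice (fun=> 1) h a v = \sum_(x : rounds n X) \prod_s Phi s (v s) (unround x s).
  rewrite /slice big_mkcond /=; apply: eq_bigr => x _; rewrite PhiE.
  by case: ifP; rewrite ?mul1r ?mul0r ?mulr1.
rewrite -H /slice big_mkcond /=; apply: eq_bigr => x _; rewrite PhiE /win /answer.
case: ifP => [/andP[_ /eqP ->]|_]; last by rewrite mul0r mulr0.
by rewrite mul1r mulrC.
Qed.

End OneMoreRound.

End WinningRounds.

(** * The induction on the number of rounds *)

Definition cons_round (n m : nat) (i : 'I_n) (c : 'I_m -> 'I_n) : 'I_m.+1 -> 'I_n :=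
  fun l => oapp c i (unlift ord0 l).

Section Repetition.
Variables (R : realType) (k n : nat) (X A : 'I_k -> finType).
Variables (mu : qspace X -> R) (V : qspace X -> qspace A -> bool).
Variables (Xp : forall t, {set X t}) (alpha eps : R).
Variables (f : strategy (repT n X) (repT n A)) (a0 : qspace A).
Hypothesis mu_ge0 : forall x, 0 <= mu x.
Hypothesis mu_sum1 : \sum_x mu x = 1.
Hypothesis mu_anchored : forall x : qspace X,
  let F := [set t | x t \in Xp t] in
  mu x = marg_restr mu (~: F) x * \prod_(t in F) marg1 mu t x.
Hypothesis alpha01 : 0 < alpha <= 1.
Hypothesis alpha_le : forall t, alpha <= anchor_mass mu Xp t.
Hypothesis eps01 : 0 < eps <= 1.
Hypothesis val_le : game_val mu V <= 1 - eps.
Hypothesis k_gt0 : (0 < k)%N.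

Notation "''P' c" := (wins_prob mu V f c (fun=> 1)) (at level 10, c at level 8).

(** If [g] were the constant [b] of [anchored_poincare], [slice_strategy] would win with weight at
    most [b * (1 - eps)]; the second term pays for the replacement. *)
Lemma one_more_round m (c : 'I_m -> 'I_n) i : ~~ inC c i ->
  wins_prob mu V f c (fun x => (win V f x i)%:R) <=
  (1 - eps) * 'P c + 2 * alpha^-1 ^+ k * (k%:R * deviation mu V f c i).
Proof.
move=> iC; have [x0 _] := qspace_inhabited mu_sum1.
have h0 : hint X := (Ordinal k_gt0, x0).
rewrite !(wins_prob_slice V f mu_ge0 k_gt0 iC h0) (deviation_slice V f mu_ge0 k_gt0 iC h0).
rewrite !mulr_sumr -big_split; apply: ler_sum => h _ /=.
rewrite !mulr_sumr -big_split; apply: ler_sum => a _ /=.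
rewrite ![_ * (weight' _ _ _ _ _ _ * _)]mulrCA -mulrDr.
apply: ler_wpM2l; first exact: weight'_ge0.
set g := slice mu f c i (fun=> 1) h a.
have g0 v : 0 <= g v by apply: slice_ge0.
have [w [w01 wE wV]] := slice_strategy V f c mu_ge0 i a0 h a.
have [b b0 Hb] := anchored_poincare mu_ge0 mu_sum1 mu_anchored alpha01 alpha_le g0.
apply: le_trans (lerD (lexx _) Hb).
(* As [0 <= w v <= 1], replacing [g v] by [b] costs at most the positive part of [g v - b]. *)
apply: le_trans (_ : \sum_v (b * (mu v * w v) + mu v * Num.max (g v - b) 0) <= _).
  apply: ler_sum => v _; rewrite wE -/g [b * _]mulrCA -mulrDr ler_wpM2l //.
  have /andP[w0 w1] := w01 v.
  have : w v * (g v - b) <= Num.max (g v - b) 0.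
    case: (leP 0 (g v - b)) => gb; first by rewrite ler_piMl.
    by rewrite mulr_ge0_le0 // ltW.
  by set z := Num.max _ _; lra.
rewrite big_split /= -mulr_sumr.
have -> : (1 - eps) * (\sum_v mu v * g v) + \sum_v mu v * `|g v - b| =
    b * (1 - eps) + \sum_v mu v * ((1 - eps) * (g v - b) + `|g v - b|).
  have -> : b * (1 - eps) = \sum_v mu v * (b * (1 - eps)).
    by rewrite -mulr_suml mu_sum1 mul1r.
  rewrite mulr_sumr -!big_split; apply: eq_bigr => v _ /=; ring.
apply: lerD; first by rewrite ler_wpM2l // (le_trans wV).
apply: ler_sum => v _; rewrite ler_wpM2l //.
have /andP[e0 e1] := eps01.
case: (leP 0 (g v - b)) => gb.
  by rewrite ger0_norm // lerDr mulr_ge0 // subr_ge0.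
rewrite ltr0_norm //; nra.
Qed.

(** At least [n - m] rounds lie outside the image of [c], and one of them is no worse than the
    average given by [deviation_sq]. *)
Lemma exists_small_deviation m (c : 'I_m -> 'I_n) : (m < n)%N -> 0 < 'P c ->
  exists2 i, ~~ inC c i &
    (n - m)%:R * deviation mu V f c i ^+ 2 <= 4 * 'P c ^+ 2 * ln (#|labels m A|%:R / 'P c).
Proof.
move=> mn P0; pose B := 4 * 'P c ^+ 2 * ln (#|labels m A|%:R / 'P c).
have HB := deviation_sq mu_ge0 mu_sum1 k_gt0 P0.
have card_notC : (n - m <= #|[pred j | ~~ inC c j]|)%N.
  have cE : (#|[pred j | inC c j]| + #|[pred j | ~~ inC c j]| = n)%N.
    by rewrite -[RHS]card_ord -(cardC [pred j | inC c j]); congr addn; apply: eq_card.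
  suff : (#|[pred j | inC c j]| <= m)%N by lia.
  rewrite -[m in leqRHS]card_ord -(size_codom c); apply: leq_trans (card_size _).
  apply: subset_leq_card; apply/subsetP => j; rewrite inE => /existsP[l /eqP <-].
  exact: codom_f.
apply: contrapT => H.
have {}H j : ~~ inC c j -> B < (n - m)%:R * deviation mu V f c j ^+ 2.
  by move=> jC; rewrite ltNge; apply/negP => le; apply: H; exists j.
have [j0 j0C] : exists j, ~~ inC c j.
  have nm : (0 < n - m)%N by rewrite subn_gt0.
  by have /card_gt0P[j jC] := leq_trans nm card_notC; exists j.
have nm0 : 0 < (n - m)%:R :> R by rewrite ltr0n subn_gt0.
have B0 : 0 <= B by apply: le_trans HB; apply: sumr_ge0 => j _; apply: sqr_ge0.
suff : B < B by rewrite ltxx.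
apply: lt_le_trans HB; rewrite -(ltr_pM2l nm0).
apply: le_lt_trans (_ : \sum_(j | ~~ inC c j) B < _).
  by rewrite sumr_const -[leRHS]mulr_natl ler_wpM2r // ler_nat.
apply: lt_le_trans (_ : \sum_(j | ~~ inC c j) (n - m)%:R * deviation mu V f c j ^+ 2 <= _).
  apply: ltr_sum; last exact: H.
  by apply/hasP; exists j0; rewrite ?mem_index_enum.
rewrite mulr_sumr; apply: ler_sum_imp => // j.
by rewrite mulr_ge0 ?sqr_ge0 // ltW.
Qed.

Lemma wins_prob_cons m (c : 'I_m -> 'I_n) i :
  'P (cons_round i c) = wins_prob mu V f c (fun x => (win V f x i)%:R).
Proof.
apply: eq_bigr => x _; rewrite mulr1 -mulrA; congr (_ * _).
rewrite -natrM mulnb; congr (nat_of_bool _)%:R; rewrite andbC.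
apply/forallP/andP => [H|[wi /forallP H] l].
  split; first by have := H ord0; rewrite /cons_round unlift_none.
  by apply/forallP => l; have := H (lift ord0 l); rewrite /cons_round liftK.
by rewrite /cons_round; case: unliftP => [l' _|_] //=.
Qed.

Lemma win_prob_le_wins m (c : 'I_m -> 'I_n) :
  win_prob (rep_mu n mu) (rep_V n V) f <= 'P c.
Proof.
rewrite /win_prob (reindex _ (onW_bij _ (unround_bij n X))) /=.
apply: ler_sum => x _; rewrite mulr1 /rep_mu.
rewrite (eq_bigr (fun j => mu (x j))) => [|j _]; last by rewrite round_unround.
apply: ler_wpM2l; first exact: prodr_ge0.
rewrite ler_nat; case: (boolP (rep_V _ _ _ _)) => // /forallP H.
suff -> : wins V f c x by [].
by apply/forallP => l; have := H (c l); rewrite round_unround.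
Qed.

Lemma wins_prob_nil (c : 'I_0 -> 'I_n) : 'P c = 1.
Proof.
rewrite /wins_prob (eq_bigr (fun x : rounds n X => \prod_j mu (x j))).
  by rewrite (sum_prod_distr (fun (_ : 'I_n) v => mu v)) big1.
move=> x _; have -> : wins V f c x by apply/forallP => -[].
by rewrite !mulr1.
Qed.

Variables (s : R).
Hypothesis s_ge1 : 1 <= s.
Hypothesis lnA : ln (#|qspace A|%:R : R) <= s.

(** [B] is the square of [eps * alpha ^+ k / k], the scale of a tolerable deviation; [gamma] is the
    rate in the theorem. *)
Let B : R := alpha ^+ (2 * k) * eps ^+ 2 / k%:R ^+ 2.
Let gamma : R := eps * B / (384 * s).

Let B01 : 0 < B <= 1.
Proof.
have /andP[a0' a1] := alpha01; have /andP[e0 e1] := eps01.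
have k1 : 1 <= (k%:R : R) by rewrite ler1n.
have k0 : 0 < (k%:R : R) by rewrite ltr0n.
rewrite /B divr_gt0 ?mulr_gt0 ?exprn_gt0 //=.
rewrite ler_pdivrMr ?exprn_gt0 // mul1r; apply: le_trans (_ : 1 <= _).
  by rewrite mulr_ile1 ?exprn_ge0 ?exprn_ile1 // ltW.
by rewrite exprn_ege1.
Qed.

(** Above the target probability, few rounds have been chosen, so little entropy is spread over the
    others. One of them has deviation at most [q / 4 * 'P c], which spoils only half of [eps]. *)
Lemma extend_rounds m (c : 'I_m -> 'I_n) : (0 < n)%N ->
  expR (- (gamma * n%:R)) < 'P c -> 'P c <= expR (- (m%:R * (eps / 2))) ->
  exists i, 'P (cons_round i c) <= (1 - eps / 2) * 'P c.
Proof.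
move=> n0 Plo Phi.
have /andP[a0' a1] := alpha01; have /andP[e0 e1] := eps01; have /andP[B0 B1] := B01.
have k0 : 0 < (k%:R : R) by rewrite ltr0n.
have s0 : 0 < s := lt_le_trans ltr01 s_ge1.
have nR : 0 < n%:R :> R by rewrite ltr0n.
have P0 : 0 < 'P c by apply: lt_trans Plo; apply: expR_gt0.
(* Multiply [m * (eps / 2) < gamma * n] by [2 * s / eps]. *)
have m_lt : m%:R * s <= B / 192 * n%:R.
  have : expR (- (gamma * n%:R)) < expR (- (m%:R * (eps / 2))) by apply: lt_le_trans Phi.
  rewrite ltr_expR ltrN2 /gamma => H.
  have -> : B / 192 * n%:R = (eps * B / (384 * s) * n%:R) * (2 * s / eps).
    by field; rewrite !lt0r_neq0.
  have -> : m%:R * s = m%:R * (eps / 2) * (2 * s / eps) by field; rewrite lt0r_neq0.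
  by apply: ler_wpM2r; [rewrite divr_ge0 // ?mulr_ge0 // ltW|exact: ltW].
have m_le : m%:R <= n%:R / 2 :> R.
  apply: le_trans (_ : m%:R * s <= _); first by rewrite ler_peMr.
  apply: le_trans m_lt _; rewrite mulrC ler_pM2l //; lra.
have mn : (m < n)%N by rewrite -(ltr_nat R); lra.
(* The labels account for [B / 192 * n] and [- ln ('P c)] for [B / 384 * n]. *)
have K_le : ln (#|labels m A|%:R / 'P c) <= B / 128 * n%:R.
  have cA : 0 < #|qspace A|%:R :> R by rewrite ltr0n; apply/card_gt0P; exists a0.
  rewrite card_ffun card_ord natrX lnM ?posrE ?exprn_gt0 ?invr_gt0 //.
  rewrite lnV ?posrE // lnXn // -[ln _ *+ m]mulr_natl.
  have l1 : m%:R * ln (#|qspace A|%:R : R) <= m%:R * s by apply: ler_wpM2l.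
  have l2 : - ln ('P c) <= gamma * n%:R.
    by rewrite -lerN2 opprK -(expRK (- (gamma * n%:R))) ler_ln ?posrE ?expR_gt0 // ltW.
  have l3 : gamma * n%:R <= B / 384 * n%:R.
    apply: ler_wpM2r; first exact: ltW.
    have d0 : 0 < 384 * s by apply: mulr_gt0 s0; rewrite ltr0n.
    rewrite /gamma ler_pdivrMr //.
    have -> : B / 384 * (384 * s) = s * B by field.
    by apply: ler_wpM2r; [exact: ltW|exact: le_trans e1 s_ge1].
  apply: le_trans (lerD (le_trans l1 m_lt) (le_trans l2 l3)) _.
  by rewrite -mulrDl (_ : B / 192 + B / 384 = B / 128) //; field.
have [i iC Hi] := exists_small_deviation mn P0.
exists i; rewrite wins_prob_cons.
apply: le_trans (one_more_round iC) _.
set D := deviation mu V f c i in Hi *.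
suff HD : 2 * alpha^-1 ^+ k * (k%:R * D) <= eps / 2 * 'P c by lra.
pose q : R := eps * alpha ^+ k / k%:R.
have qB : q ^+ 2 = B by rewrite /q /B expr_div_n exprMn -exprM mulnC [_ * alpha ^+ _]mulrC.
have q0 : 0 < q by rewrite /q divr_gt0 // mulr_gt0 ?exprn_gt0.
suff HD : D <= q / 4 * 'P c.
  have -> : eps / 2 * 'P c = 2 * alpha^-1 ^+ k * (k%:R * (q / 4 * 'P c)).
    by rewrite /q exprVn; field; rewrite lt0r_neq0 //= expf_neq0 // lt0r_neq0.
  by rewrite ler_pM2l ?mulr_gt0 ?exprn_gt0 ?invr_gt0 // ler_pM2l.
have qP0 : 0 <= q / 4 * 'P c by rewrite mulr_ge0 ?(ltW P0) // divr_ge0 // ltW.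
have [D0|D0] := leP D 0; first exact: le_trans D0 qP0.
rewrite -(@ler_pXn2r _ 2) ?nnegrE ?(ltW D0) //.
have -> : (q / 4 * 'P c) ^+ 2 = B / 16 * 'P c ^+ 2 by rewrite -qB; field.
have nm : n%:R / 2 <= (n - m)%:R :> R by rewrite natrB 1?ltnW //; lra.
(* With [n / 2 <= n - m] this amounts to [D ^+ 2 <= B / 16 * 'P c ^+ 2]. *)
have h1 : n%:R / 2 * D ^+ 2 <= 4 * 'P c ^+ 2 * (B / 128 * n%:R).
  apply: le_trans (_ : (n - m)%:R * D ^+ 2 <= _); first by rewrite ler_wpM2r ?sqr_ge0.
  by apply: le_trans Hi _; rewrite ler_wpM2l // mulr_ge0 ?sqr_ge0.
have n2 : 0 < n%:R / 2 :> R by lra.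
rewrite -(ler_pM2l n2); apply: le_trans h1 _.
by rewrite le_eqVlt; apply/orP; left; apply/eqP; field.
Qed.

(** Otherwise [extend_rounds] applies forever and ['P c] decays geometrically in [m], although it
    never drops below the probability of winning all rounds. *)
Lemma rep_win_prob_le : (0 < n)%N ->
  win_prob (rep_mu n mu) (rep_V n V) f <= expR (- (gamma * n%:R)).
Proof.
move=> n0; rewrite leNgt; apply/negP => Hlt.
have /andP[e0 e1] := eps01.
have H m : exists c : 'I_m -> 'I_n, 'P c <= expR (- (m%:R * (eps / 2))).
  elim: m => [|m [c Hc]].
    by exists (fun=> Ordinal n0); rewrite wins_prob_nil mul0r oppr0 expR0.
  have [i Hi] := extend_rounds n0 (lt_le_trans Hlt (win_prob_le_wins c)) Hc.
  exists (cons_round i c); apply: le_trans Hi _.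
  have -> : - (m.+1%:R * (eps / 2)) = - (eps / 2) + - (m%:R * (eps / 2)).
    by rewrite -natr1; ring.
  rewrite expRD; apply: ler_pM => //; first by lra.
    apply: le_trans (win_prob_le_wins c).
    apply: sumr_ge0 => x _; rewrite mulr_ge0 //; exact: prodr_ge0.
  exact: expR_ge1Dx.
(* Large enough that [m * (eps / 2)] exceeds [gamma * n]. *)
pose m := (Num.truncn (gamma * n%:R * (2 / eps))).+1.
have [c Hc] := H m.
have := lt_le_trans Hlt (le_trans (win_prob_le_wins c) Hc).
rewrite ltr_expR ltrN2; apply/negP; rewrite -leNgt.
have -> : gamma * n%:R = gamma * n%:R * (2 / eps) * (eps / 2) by field; rewrite lt0r_neq0.
apply: ler_wpM2r; first by lra.
exact/ltW/truncnS_gt.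
Qed.

End Repetition.

Theorem theorem4p1 (R : realType) (k : nat) (X A : 'I_k -> finType)
  (mu : qspace X -> R) (V : qspace X -> qspace A -> bool)
  (alpha eps : R) (n : nat) :
  is_prob mu ->
  anchored alpha mu ->
  game_val mu V <= 1 - eps ->
  (0 < n)%N ->
  game_val (rep_mu n mu) (rep_V n V) <=
    expR (- (alpha ^+ (2 * k) * eps ^+ 3 * n%:R) /
           (384 * log_answers A * k%:R ^+ 2)).
Proof.
move=> [mu_ge0 mu_sum1] [alpha01 [Xp [alpha_le mu_anchored]]] val_le n0.
set s : R := log_answers A.
apply: bigmax_le => [|f _]; first exact/ltW/expR_gt0.
have ln2_gt0 : 0 < ln 2 :> R by rewrite ln_gt0 // ltr1n.
have s_ge0 : 0 <= s.
  rewrite divr_ge0 ?(ltW ln2_gt0) //.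
  case: #|qspace A| => [|a]; first by rewrite ln0.
  by rewrite ln_ge0 // ler1n.
(* For the degenerate cases: when [k = 0] or [s = 0] the exponent divides by zero and is 0, and when
   [eps <= 0] it is nonnegative. *)
have trivial_bound (e : R) : 0 <= e -> win_prob (rep_mu n mu) (rep_V n V) f <= expR e.
  move=> e0; apply: le_trans (_ : 1 <= _); last by rewrite -expR0 ler_expR.
  rewrite -(wins_prob_nil V f mu_sum1 (fun=> Ordinal n0)).
  exact: win_prob_le_wins.
have [k0|k_gt0] := posnP k.
  by apply: trivial_bound; rewrite k0 expr0n /= mulr0 invr0 mulr0.
have [s0|s_neq0] := eqVneq s 0.
  by apply: trivial_bound; rewrite s0 mulr0 mul0r invr0 mulr0.
have /andP[a_gt0 a_le1] := alpha01.
have [e_le0|e_gt0] := leP eps 0.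
  apply: trivial_bound; apply: divr_ge0; last first.
    by apply: mulr_ge0 (sqr_ge0 _); apply: mulr_ge0 s_ge0; rewrite ler0n.
  rewrite oppr_ge0.
  rewrite mulr_le0_ge0 // mulr_ge0_le0 ?exprn_ge0 ?(ltW a_gt0) //.
  by rewrite exprS mulr_le0_ge0 // sqr_ge0.
have e_le1 : eps <= 1.
  rewrite -subr_ge0; apply: le_trans val_le.
  exact: bigmax_ge_id.
have s_gt0 : 0 < s by rewrite lt_neqAle eq_sym s_neq0.
(* Positive [s] forces two joint answers, so the base-2 logarithm is at least 1. *)
have A2 : (1 < #|qspace A|)%N.
  rewrite ltnNge; apply/negP => A1; move: s_gt0; rewrite ltNge => /negP; apply.
  rewrite /s /log_answers ler_pdivrMr // mul0r ln_le0 //.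
  by rewrite -[1]/(1%:R) ler_nat.
have /card_gt0P[a0 _] := ltnW A2.
have s_ge1 : 1 <= s.
  by rewrite /s /log_answers ler_pdivlMr // mul1r ler_ln ?posrE ?ltr0n ?ler_nat // ltnW.
(* Natural logarithms are smaller than base-2 ones because [ln 2 <= 1]. *)
have lnA : ln (#|qspace A|%:R : R) <= s.
  rewrite /s /log_answers ler_pdivlMr // ler_piMr //.
    by rewrite ln_ge0 // ler1n ltnW.
  by have := @ln_le_sub1 R 2; rewrite ltr0n => /(_ isT); lra.
have alpha_le' t : alpha <= anchor_mass mu Xp t by rewrite anchor_massE.
have eps01 : 0 < eps <= 1 by rewrite e_gt0.
have := rep_win_prob_le f a0 mu_ge0 mu_sum1 mu_anchored alpha01 alpha_le' eps01 val_le
  k_gt0 s_ge1 lnA n0.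
congr (_ <= expR _); field.
by rewrite pnatr_eq0 -lt0n k_gt0.
Qed.
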